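(* Let $\Omega\subset\mathbb{R}^d$ be open and let $\Phi$ be a Musielak-Orlicz function on $\Omega$. If $|\operatorname{Sing}\Phi|=0$, then $C_C^\infty(\Omega)\cap E^\Phi(\Omega)$ is dense in $(E^\Phi(\Omega),\|\cdot\|_\Phi)$; in other words, $\overline{C_C^\infty(\Omega)\cap E^\Phi(\Omega)}=E^\Phi(\Omega)$, the closure being taken in the norm $\|\cdot\|_\Phi$.
   Context: $|\cdot|$ denotes Lebesgue measure on $\mathbb{R}^d$, and $L^0(\Omega)$ is the set of all Lebesgue measurable complex-valued functions on $\Omega$. A Musielak-Orlicz function on $\Omega$ is a function $\Phi:\Omega\times[0,\infty)\to[0,\infty)$ such that: (a) for every $x\in\Omega$, $t\mapsto\Phi(x,t)$ is convex; (b) for every $x\in\Omega$, $\Phi(x,t)=0$ if and only if $t=0$; (c) for every $t\in[0,\infty)$, $x\mapsto\Phi(x,t)$ is Lebesgue measurable on $\Omega$. Put $I_\Phi(f)=\int_\Omega\Phi(x,|f(x)|)\,dx$ for $f\in L^0(\Omega)$. The Musielak-Orlicz space is $L^\Phi(\Omega)=\{f\in L^0(\Omega):\exists\lambda>0,\ I_\Phi(\lambda f)<\infty\}$, normed by $\|f\|_\Phi=\inf\{\lambda>0: I_\Phi(f/\lambda)\le 1\}$, and $E^\Phi(\Omega)=\{f\in L^0(\Omega):\forall\lambda>0,\ I_\Phi(\lambda f)<\infty\}$ is a closed subspace (functions equal a.e. are identified). $C_C^\infty(\Omega)$ is the set of infinitely differentiable complex-valued functions on $\Omega$ with compact support contained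 in $\Omega$. The set of singular points of $\Phi$ is $\operatorname{Sing}\Phi=\{x\in\mathbb{R}^d:\ \forall r>0\ \exists t_r>0,\ \int_{B(x,r)\cap\Omega}\Phi(y,t_r)\,dy=\infty\}$, where $B(x,r)$ is the open Euclidean ball with center $x$ and radius $r$. *)

(* Defs.v *)
From HB Require Import structures.
From mathcomp Require Import all_boot all_order all_algebra.
From mathcomp Require Import all_classical all_reals all_analysis.
From mathcomp Require Import complex.

Set Implicit Arguments.
Unset Strict Implicit.
Unset Printing Implicit Defensive.

Import Order.TTheory GRing.Theory Num.Theory.
Import numFieldNormedType.Exports.
Import ComplexField.Normc.

Local Open Scope classical_set_scope.
Local Open Scope ring_scope.

Section lebesgue_measure_Rd.
Context (R : realType) (d : nat).
Implicit Types (a b : 'rV[R]_d) (A : set 'rV[R]_d).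

Definition box a b : set 'rV[R]_d :=
  [set x | forall i, a ord0 i < x ord0 i < b ord0 i].

Definition box_volume a b : R := \prod_(i < d) (b ord0 i - a ord0 i).

(* The covers are indexed by an arbitrary set D of naturals rather than by all
   of nat, so that the empty set has measure 0 also when d = 0, where the only
   box is the whole space and has volume 1. *)
Definition box_cover A (D : set nat) (a b : nat -> 'rV[R]_d) : Prop :=
  (forall k, D k -> forall i, a k ord0 i <= b k ord0 i) /\
  A `<=` \bigcup_(k in D) box (a k) (b k).

Definition lebesgue_outer A : \bar R :=
  ereal_inf [set v | exists D (a b : nat -> 'rV[R]_d), box_cover A D a b /\
    v = \esum_(k in D) (box_volume (a k) (b k))%:E].

Lemma box_volume_ge0 A D (a b : nat -> 'rV[R]_d) : box_cover A D a b ->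
  forall k, D k -> (0 <= (box_volume (a k) (b k))%:E)%E.
Proof.
move=> [ab _] k Dk; rewrite lee_fin; apply: prodr_ge0 => i _.
by rewrite subr_ge0 ab.
Qed.

Lemma lebesgue_outer_ge0 A : (0 <= lebesgue_outer A)%E.
Proof.
apply: le_ereal_inf_tmp => _ [D [a [b [c ->]]]].
by apply: esum_ge0 => k; exact: box_volume_ge0 c k.
Qed.

Lemma lebesgue_outer0 : lebesgue_outer set0 = 0%E.
Proof.
apply/eqP; rewrite eq_le lebesgue_outer_ge0 andbT.
apply: ereal_inf_lbound; exists set0, (fun=> 0), (fun=> 0).
by rewrite esum_set0; split => //; split.
Qed.

Lemma le_lebesgue_outer :
  {homo lebesgue_outer : A B / A `<=` B >-> (A <= B)%E}.
Proof.
move=> A B AB; apply: ereal_inf_le_tmp => _ [D [a [b [[ab c] ->]]]].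
by exists D, a, b; split => //; split => //; exact: subset_trans c.
Qed.

Lemma lebesgue_outer_sigma_subadditive : sigma_subadditive lebesgue_outer.
Proof.
move=> A; have [[i ioo]|] := pselect (exists i, lebesgue_outer (A i) = +oo%E).
  rewrite (eseries_pinfty _ _ ioo) ?leey// => n _.
  by rewrite -ltNye (lt_le_trans _ (lebesgue_outer_ge0 _)).
rewrite -forallNE => Aoo.
suff add2e (e : {posnum R}) :
    (lebesgue_outer (\bigcup_n A n)
      <= \sum_(i <oo) lebesgue_outer (A i) + e%:num%:E)%E.
  by apply/lee_addgt0Pr => _/posnumP[].
rewrite (le_trans _ (epsilon_trick _ _ _))//; last first.
  by move=> n; exact: lebesgue_outer_ge0.
pose P n (B : set nat * (nat -> 'rV[R]_d) * (nat -> 'rV[R]_d)) :=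
  box_cover (A n) B.1.1 B.1.2 B.2 /\
  (\esum_(k in B.1.1) (box_volume (B.1.2 k) (B.2 k))%:E
    <= lebesgue_outer (A n) + (e%:num / (2 ^ n.+1)%:R)%:E)%E.
have [G PG] : {G & forall n, P n (G n)}.
  apply: (@choice _ _ P) => n; rewrite /P /lebesgue_outer.
  set S := (X in ereal_inf X).
  have Sfin : ereal_inf S \is a fin_num.
    rewrite fin_numE; apply/andP; split; last exact/eqP/Aoo.
    by rewrite -ltNye (lt_le_trans _ (lebesgue_outer_ge0 (A n))).
  have en1 : 0 < e%:num / (2 ^ n.+1)%:R :> R by [].
  have [x [D [a [b [c ->]]]] xS] := lb_ereal_inf_adherent en1 Sfin.
  by exists (D, a, b); split => //=; exact: ltW.
pose K : set (nat * nat) := [set nk | (G nk.1).1.1 nk.2].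
pose va (nk : nat * nat) := (G nk.1).1.2 nk.2.
pose vb (nk : nat * nat) := (G nk.1).2 nk.2.
have vol0 nk : K nk -> (0 <= (box_volume (va nk) (vb nk))%:E)%E.
  by move=> Knk; exact: (box_volume_ge0 (PG nk.1).1).
apply: (@le_trans _ _ (\esum_(nk in K) (box_volume (va nk) (vb nk))%:E)).
  apply: ereal_inf_lbound => /=.
  have /card_esym/ppcard_eqP[f] := card_nat2.
  exists (f @^-1` K), (va \o f), (vb \o f); split.
    split => [k /= Kk i|x [n _ Anx]]; first exact: (PG (f k).1).1.1.
    have [k Dk bx] := (PG n).1.2 _ Anx.
    by exists (f^-1%FUN (n, k)); rewrite /= /K /va /vb /= invK ?inE.
  rewrite (reindex_esum (f @^-1` K) K f) //.
  split => //; first by move=> x y _ _; apply: inj; rewrite inE.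
  by move=> nk Knk; exists (f^-1%FUN nk); rewrite /= invK ?inE.
have -> : K = [set: nat] `*`` (fun n => (G n).1.1).
  by apply/seteqP; split => -[n k] //= [].
rewrite -(esum_esum (a := fun n k => (box_volume (va (n, k)) (vb (n, k)))%:E)).
  rewrite nneseries_esumT; last first.
    move=> n; rewrite (le_trans (lebesgue_outer_ge0 (A n)))// leeDl// lee_fin.
  by apply: le_esum => n _; exact: (PG n).2.
by move=> n k _ Dk; exact: (vol0 (n, k)).
Qed.

HB.instance Definition _ := isOuterMeasure.Build R 'rV[R]_d lebesgue_outer
  lebesgue_outer0 lebesgue_outer_ge0 le_lebesgue_outer
  lebesgue_outer_sigma_subadditive.

(* R^d with the sigma-algebra of Lebesgue (Caratheodory) measurable sets;
   a type alias, convertible to 'rV[R]_d, which carries the topology. *)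
Definition lebesgueRdType := caratheodory_type lebesgue_outer.
HB.instance Definition _ := Measurable.on lebesgueRdType.

Definition lebesgueRd : set lebesgueRdType -> \bar R := lebesgue_outer.
HB.instance Definition _ := isMeasure.Build _ lebesgueRdType R lebesgueRd
  (@caratheodory_measure0 _ _ _) (@caratheodory_measure_ge0 _ _ _)
  (@caratheodory_measure_sigma_additive _ _ _).

End lebesgue_measure_Rd.

Section smooth_functions.
Context (R : realType) (d : nat).

Fixpoint classC (k : nat) (u : 'rV[R]_d -> R) : Prop :=
  continuous u /\
  if k is k'.+1 then
    forall i : 'I_d, (forall x, derivable u x (delta_mx ord0 i)) /\
      classC k' (fun x => 'D_(delta_mx ord0 i) u x)
  else True.

Definition smooth (f : 'rV[R]_d -> R[i]) : Prop :=
  forall k, classC k (fun x => complex.Re (f x)) /\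
            classC k (fun x => complex.Im (f x)).

Definition supp (f : 'rV[R]_d -> R[i]) : set 'rV[R]_d :=
  closure [set x | f x != 0].

(* Elements are extended by 0 outside Omega. *)
Definition CCinfty (Omega : set 'rV[R]_d) : set ('rV[R]_d -> R[i]) :=
  [set f | [/\ smooth f, compact (supp f) & supp f `<=` Omega]].

End smooth_functions.

(* A function on Omega (resp. on Omega x [0, +oo[) is represented by a total
   function on R^d (resp. on R^d x R); the values outside the domain are
   irrelevant.  Spaces of functions are sets of representatives: no quotient by
   equality almost everywhere is taken, all the notions below being invariant
   under it. *)
Section musielak_orlicz.
Context (R : realType) (d : nat).
Implicit Types (Omega : set 'rV[R]_d) (Phi : 'rV[R]_d -> R -> R)
  (f : 'rV[R]_d -> R[i]).

Local Notation mu := (@lebesgueRd R d).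

Definition L0 Omega : set ('rV[R]_d -> R[i]) :=
  [set f |
    measurable_fun (Omega : set (lebesgueRdType R d))
      (fun x => complex.Re (f x)) /\
    measurable_fun (Omega : set (lebesgueRdType R d))
      (fun x => complex.Im (f x))].

Definition musielak_orlicz Omega Phi : Prop :=
  [/\ (forall x t, Omega x -> 0 <= t -> 0 <= Phi x t),
      (forall x, Omega x ->
         convex_function ([set t | 0 <= t] : set (convex_lmodType R^o)) (Phi x)),
      (forall x t, Omega x -> 0 <= t -> (Phi x t = 0 <-> t = 0)) &
      (forall t, 0 <= t ->
         measurable_fun (Omega : set (lebesgueRdType R d)) (Phi ^~ t))].

Definition modular Omega Phi f : \bar R :=
  (\int[mu]_(x in Omega) (Phi x (normc (f x)))%:E)%E.

Definition LPhi Omega Phi : set ('rV[R]_d -> R[i]) :=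
  [set f | L0 Omega f /\ exists2 l : R, 0 < l &
    (modular Omega Phi (fun x => (l%:C)%C * f x)%R < +oo)%E].

Definition EPhi Omega Phi : set ('rV[R]_d -> R[i]) :=
  [set f | L0 Omega f /\ forall l : R, 0 < l ->
    (modular Omega Phi (fun x => (l%:C)%C * f x)%R < +oo)%E].

(* Extended-real valued, so that the infimum of the empty set is +oo; it is
   finite on LPhi. *)
Definition luxemburg Omega Phi f : \bar R :=
  ereal_inf [set l%:E | l in
    [set l : R | 0 < l /\ (modular Omega Phi (fun x => f x / (l%:C)%C)%R <= 1)%E]].

Definition norm_closure Omega Phi (A : set ('rV[R]_d -> R[i])) :
    set ('rV[R]_d -> R[i]) :=
  [set f | LPhi Omega Phi f /\ forall e : R, 0 < e ->
    exists2 g, A g & (luxemburg Omega Phi (fun x => f x - g x)%R < e%:E)%E].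

(* Balls are Euclidean; the library's [ball] on 'rV is that of the sup norm. *)
Definition eball (x : 'rV[R]_d) (r : R) : set 'rV[R]_d :=
  [set y | Num.sqrt (\sum_(i < d) (y ord0 i - x ord0 i) ^+ 2) < r].

Definition Sing Omega Phi : set 'rV[R]_d :=
  [set x | forall r : R, 0 < r -> exists2 t : R, 0 < t &
    (\int[mu]_(y in eball x r `&` Omega) (Phi y t)%:E = +oo)%E].

End musielak_orlicz.

(* Main.v *)
(* The modular I_Phi is absolutely continuous: if u_n -> u almost everywhere and
   |u_n| <= h with all the modulars of h finite, then I_Phi(l (u - u_n)) -> 0 for
   every l, by dominated convergence, Phi(x, .) being nondecreasing and
   continuous at 0.  Hence the set of real functions that are limits of smooth
   ones, for all the dilated modulars at once, is closed under sums, scaling and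
   dominated almost everywhere limits, and four such limits suffice.  The
   indicator of an open set O whose dilates have finite modulars is a pointwise
   limit of smooth functions with compact support in O and values in [0, 1]; the
   indicator of a measurable subset of O is almost everywhere a limit of
   indicators of open sets, by outer regularity; this gives simple functions, and
   then all nonnegative u in E^Phi.  A point of Omega that is not singular lies in
   a rational box on which every Phi(., t) is integrable, so finite unions of
   these boxes exhaust Omega up to the null set Sing Phi, and their indicators
   have finite modulars. *)
Require Import Defs.
From mathcomp Require Import all_boot all_order all_algebra.
From mathcomp Require Import all_classical all_reals all_analysis.
From mathcomp Require Import measurable_realfun complex zify ring lra.

Set Implicit Arguments.
Unset Strict Implicit.
Unset Printing Implicit Defensive.

Import Order.TTheory GRing.Theory Num.Theory.
Import numFieldNormedType.Exports.

Local Open Scope classical_set_scope.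
Local Open Scope ring_scope.

(** * Lebesgue measurability and outer regularity in R^d *)

Section lebesgue_Rd_measurability.
Context (R : realType) (d : nat).
Implicit Types (a b : 'rV[R]_d) (i : 'I_d).
Local Notation mu := (@lebesgueRd R d).
Local Notation T := (lebesgueRdType R d).

Definition upd a i (v : R) : 'rV[R]_d :=
  \row_j (if j == i then v else a ord0 j).

Lemma updE a i v j : upd a i v ord0 j = if j == i then v else a ord0 j.
Proof. by rewrite mxE. Qed.

Lemma box_volume_split a b i : box_volume a b =
  (b ord0 i - a ord0 i) * \prod_(j < d | j != i) (b ord0 j - a ord0 j).
Proof. by rewrite /box_volume (bigD1 i). Qed.

Lemma box_volume_updl a b i v : box_volume (upd a i v) b =
  (b ord0 i - v) * \prod_(j < d | j != i) (b ord0 j - a ord0 j).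
Proof.
rewrite (box_volume_split _ _ i) updE eqxx; congr (_ * _).
by apply: eq_bigr => j /negbTE ji; rewrite updE ji.
Qed.

Lemma box_volume_updr a b i v : box_volume a (upd b i v) =
  (v - a ord0 i) * \prod_(j < d | j != i) (b ord0 j - a ord0 j).
Proof.
rewrite (box_volume_split _ _ i) updE eqxx; congr (_ * _).
by apply: eq_bigr => j /negbTE ji; rewrite updE ji.
Qed.

Lemma lebesgue_outer_cover (A : set 'rV[R]_d) (e : R) : 0 < e ->
  (lebesgue_outer A < +oo)%E ->
  exists D (a b : nat -> 'rV[R]_d), box_cover A D a b /\
    (\esum_(k in D) (box_volume (a k) (b k))%:E <= lebesgue_outer A + e%:E)%E.
Proof.
move=> e0 Aoo.
have Afin : ereal_inf [set v | exists D (a b : nat -> 'rV[R]_d),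
    box_cover A D a b /\ v = \esum_(k in D) (box_volume (a k) (b k))%:E]
    \is a fin_num.
  by rewrite ge0_fin_numE ?(lebesgue_outer_ge0 A).
have [x [D [a [b [c ->]]]] xA] := lb_ereal_inf_adherent e0 Afin.
by exists D, a, b; split => //; exact: ltW.
Qed.

(* A box meets the closed half-space [x_i >= c] in a set that is not a box, so
   it is covered by the box starting at [c - eta k]; the total excess of volume
   is at most e. *)
Lemma halfspace_caratheodory i (c : R) :
  (@lebesgue_outer R d).-caratheodory [set x | x ord0 i < c].
Proof.
apply: le_caratheodory_measurable => X /=.
have [Xoo|] := ltP (lebesgue_outer X) +oo%E; last first.
  by rewrite leye_eq => /eqP ->; rewrite leey.
apply/lee_addgt0Pr => e e0.
have e20 : 0 < e / 2 by rewrite divr_gt0.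
have [D [a [b [[ab XD] volX]]]] := lebesgue_outer_cover e20 Xoo.
pose P k := \prod_(j < d | j != i) (b k ord0 j - a k ord0 j).
have P0 k : D k -> 0 <= P k.
  by move=> Dk; apply: prodr_ge0 => j _; rewrite subr_ge0 ab.
(* Adding 1 to the cross-section [P k] avoids a division by zero; the excess [eta k * P k] is still
   at most (e / 2) / 2^(k+1), which sums to at most e / 2. The other half of e pays for the
   near-optimal cover. *)
pose eta k := (e / 2) / (2 ^ k.+1)%:R / (P k + 1).
have eta0 k : D k -> 0 < eta k.
  move=> Dk; rewrite /eta divr_gt0 ?divr_gt0 ?ltr0n ?expn_gt0 //.
  by rewrite ltr_wpDl ?P0.
(* The outer [max] with the left end and, in [a'], the outer [min] with the right end keep the cut
   boxes well formed when the hyperplane misses the box. *)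
pose b' k := upd (b k) i (Order.max (a k ord0 i) (Order.min (b k ord0 i) c)).
pose a' k :=
  upd (a k) i (Order.min (b k ord0 i) (Order.max (a k ord0 i) (c - eta k))).
have cov1 : box_cover (X `&` [set x | x ord0 i < c]) D a b'.
  split=> [k Dk j|x [Xx /= xc]].
    by rewrite updE; case: eqP => [->|_]; [rewrite le_max lexx|exact: ab].
  have [k Dk kx] := XD _ Xx; exists k => // j; rewrite updE.
  have /andP[ax xb] := kx j.
  case: eqP => [ji|_]; last by rewrite ax.
  by subst j; rewrite ax lt_max lt_min xb xc orbT.
have cov2 : box_cover (X `&` ~` [set x | x ord0 i < c]) D a' b.
  split=> [k Dk j|x [Xx /= xc]].
    by rewrite updE; case: eqP => [->|_]; [rewrite ge_min lexx|exact: ab].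
  have [k Dk kx] := XD _ Xx; exists k => // j; rewrite updE.
  have /andP[ax xb] := kx j.
  case: eqP => [ji|_]; last by rewrite ax.
  subst j; rewrite xb andbT gt_min gt_max ax /= ltrBlDr.
  have cx : c <= x ord0 i by rewrite leNgt; apply/negP.
  by rewrite (le_lt_trans cx) ?orbT // ltrDl eta0.
have vol1 := box_volume_ge0 cov1.
have vol2 := box_volume_ge0 cov2.
have -> : e = e / 2 + e / 2 by rewrite -splitr.
rewrite EFinD addeA.
apply: le_trans (leeD2r _ volX).
apply: (@le_trans _ _ (\esum_(k in D) (box_volume (a k) (b' k))%:E +
                       \esum_(k in D) (box_volume (a' k) (b k))%:E)%E).
  by apply: leeD; apply: ereal_inf_lbound; [exists D, a, b'|exists D, a', b].
rewrite -esumD //.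
apply: (@le_trans _ _ (\esum_(k in D)
    ((box_volume (a k) (b k))%:E + ((e / 2) / (2 ^ k.+1)%:R)%:E)%E)).
  apply: le_esum => k Dk; rewrite -!EFinD lee_fin.
  rewrite box_volume_updl box_volume_updr (box_volume_split _ _ i) -/(P k).
  rewrite -mulrDl.
  apply: (@le_trans _ _ ((b k ord0 i - a k ord0 i + eta k) * P k)).
    apply: ler_wpM2r; first exact: P0.
    have := ab _ Dk i; have := eta0 _ Dk.
    rewrite /Order.max /Order.min.
    by repeat case: ifPn; rewrite -?leNgt; lra.
  rewrite mulrDl lerD2l /eta -[leLHS]mulrA ger_pMr; last first.
    by rewrite divr_gt0 ?ltr0n ?expn_gt0.
  by rewrite mulrC ler_pdivrMr ?mul1r ?lerDl // ltr_wpDl ?P0.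
rewrite esum_mkcond [in leRHS]esum_mkcond.
have vol0 k : (0 <= if k \in D then (box_volume (a k) (b k))%:E else 0)%E.
  case: ifPn => //; rewrite inE => Dk.
  exact: (box_volume_ge0 (conj ab XD)).
have e2k k : 0 <= (e / 2) / (2 ^ k.+1)%:R by rewrite divr_ge0 ?ltW.
have vole k : (0 <= if k \in D then
    (box_volume (a k) (b k))%:E + ((e / 2) / (2 ^ k.+1)%:R)%:E else 0)%E.
  case: ifPn => //; rewrite inE => Dk.
  by apply: adde_ge0; [exact: (box_volume_ge0 (conj ab XD))|rewrite lee_fin].
rewrite -!nneseries_esumT //.
apply: (@le_trans _ _ (\sum_(k <oo)
   ((if k \in D then (box_volume (a k) (b k))%:E else 0) +
    ((e / 2) / (2 ^ k.+1)%:R)%:E))%E).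
  apply: lee_nneseries => [k _ _|k _]; first exact: vole.
  by case: ifPn => // _; rewrite add0e lee_fin.
by apply: epsilon_trick => //; exact: ltW.
Qed.

Lemma measurable_coord i : measurable_fun [set: T] (fun x : T => x ord0 i).
Proof.
apply: (measurability _ (RGenInftyO.measurableE R)) => //.
move=> _ [_ [c ->] <-]; rewrite setTI.
rewrite [X in measurable X](_ : _ = [set x : T | x ord0 i < c]).
  exact: halfspace_caratheodory.
by apply/seteqP; split => x /=; rewrite in_itv.
Qed.

Lemma measurable_box a b : measurable (box a b : set T).
Proof.
have -> : box a b = \big[setI/setT]_(i < d)
    ((fun x : T => x ord0 i) @^-1` `]a ord0 i, b ord0 i[%classic).
  apply/seteqP; split => x /=.
    by move=> abx; rewrite -bigcap_seq => i _ /=; rewrite in_itv; exact: abx.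
  rewrite -bigcap_seq => abx i; have /= := abx i (mem_index_enum _).
  by rewrite in_itv.
apply: bigsetI_measurable => i _; rewrite -[X in measurable X]setTI.
exact: measurable_coord.
Qed.

Lemma lebesgueRd_box_lty a b : (mu (box a b) < +oo)%E.
Proof.
(* A box is an admissible cover of itself only if its ends are in order, which a point of the box
   guarantees; an empty box has measure 0. *)
have [[x abx]|box0] := pselect (box a b !=set0).
  apply: (@le_lt_trans _ _ (box_volume a b)%:E); last exact: ltry.
  apply: ereal_inf_lbound; exists [set 0%N], (fun=> a), (fun=> b); split.
    split=> [k _ i|y aby]; last by exists 0%N.
    by have /andP[] := abx i; move=> /lt_trans /[apply] /ltW.
  rewrite esum_set1 // lee_fin; apply: prodr_ge0 => i _.
  by have /andP[] := abx i; move=> /lt_trans /[apply]; rewrite subr_ge0 => /ltW.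
suff -> : box a b = set0 by rewrite measure0.
by rewrite -subset0 => x abx; apply: box0; exists x.
Qed.

Lemma open_box a b : open (box a b).
Proof.
have -> : box a b = \big[setI/setT]_(i < d)
    ((fun x : 'rV[R]_d => x ord0 i) @^-1` `]a ord0 i, b ord0 i[%classic).
  apply/seteqP; split => x /=.
    by move=> abx; rewrite -bigcap_seq => i _ /=; rewrite in_itv; exact: abx.
  rewrite -bigcap_seq => abx i; have /= := abx i (mem_index_enum _).
  by rewrite in_itv.
elim/big_ind: _ => //; [exact: openT|exact: openI|move=> i _].
apply: open_comp; last exact: itv_open.
by move=> x _; exact: coord_continuous.
Qed.

(* The boxes with rational vertices, enumerated with repetitions and the empty
   set as junk value. *)
Definition ratbox (n : nat) : set 'rV[R]_d :=
  if unpickle n is Some ab then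
    box (map_mx ratr (ab : 'rV[rat]_d * 'rV[rat]_d).1) (map_mx ratr ab.2)
  else set0.

Lemma ratboxP n :
  (exists a b, ratbox n = box a b) \/ ratbox n = set0.
Proof.
by rewrite /ratbox; case: unpickle => [ab|]; [left; do 2 eexists|right].
Qed.

Lemma open_ratbox n : open (ratbox n).
Proof.
by have [[a [b ->]]|->] := ratboxP n; [exact: open_box|exact: open0].
Qed.

Lemma measurable_ratbox n : measurable (ratbox n : set T).
Proof.
by have [[a [b ->]]|->] := ratboxP n; [exact: measurable_box|].
Qed.

Lemma lebesgueRd_ratbox_lty n : (mu (ratbox n) < +oo)%E.
Proof.
have [[a [b ->]]|->] := ratboxP n; first exact: lebesgueRd_box_lty.
by rewrite measure0.
Qed.

Lemma ratbox_near (x : 'rV[R]_d) (r : R) : 0 < r -> exists n, ratbox n x /\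
  forall y, ratbox n y -> forall i, `|y ord0 i - x ord0 i| < r.
Proof.
move=> r0.
have /choice[q qP] : forall i : 'I_d, exists q : rat * rat,
    ratr q.1 \in (`]x ord0 i - r, x ord0 i[) /\
    ratr q.2 \in `]x ord0 i, x ord0 i + r[.
  move=> i.
  have [p pP] : exists p : rat, ratr p \in (`]x ord0 i - r, x ord0 i[).
    by apply: rat_in_itvoo; rewrite ltrBlDr ltrDl.
  have [q qP] : exists q : rat, ratr q \in (`]x ord0 i, x ord0 i + r[).
    by apply: rat_in_itvoo; rewrite ltrDl.
  by exists (p, q).
pose ab : 'rV[rat]_d * 'rV[rat]_d := (\row_i (q i).1, \row_i (q i).2).
exists (pickle ab); rewrite /ratbox pickleK; split => [i|y + i].
  by rewrite !mxE; have [] := qP i; rewrite !in_itv/= => /andP[_ ->] /andP[->].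
move=> /(_ i); rewrite !mxE; have [] := qP i; rewrite !in_itv/=.
rewrite ltr_norml.
by move=> /andP[h1 h2] /andP[h3 h4] /andP[h5 h6]; apply/andP; split; lra.
Qed.

Lemma open_ratbox_nbhs (O : set 'rV[R]_d) x : open O -> O x ->
  exists2 n, ratbox n x & ratbox n `<=` O.
Proof.
move=> oO Ox; have /nbhs_ballP[r /= r0 rO] : nbhs x O by exact: open_nbhs_nbhs.
have [n [nx nr]] := ratbox_near x r0; exists n => // y ny; apply: rO.
by split=> // j k; rewrite (ord1 j) /= /ball/= distrC; exact: nr.
Qed.

Lemma open_bigcup_ratbox (O : set 'rV[R]_d) : open O ->
  O = \bigcup_(n in [set n | ratbox n `<=` O]) ratbox n.
Proof.
move=> oO; apply/seteqP; split => [x Ox|x [n]]; last exact.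
by have [n nx nO] := open_ratbox_nbhs oO Ox; exists n.
Qed.

(** Half-spaces make boxes measurable, and an open set is the countable union of the rational boxes
    that it contains. *)
Lemma open_measurable_Rd (O : set 'rV[R]_d) : open O -> measurable (O : set T).
Proof.
move=> /open_bigcup_ratbox ->; apply: bigcup_measurable => n _.
exact: measurable_ratbox.
Qed.

Lemma continuous_measurable_Rd (f : 'rV[R]_d -> R) : continuous f ->
  measurable_fun [set: T] (f : T -> R).
Proof.
move=> /continuousP cf; apply: (measurability _ (RGenOpens.measurableE R)) => //.
move=> _ [_ [a [b ->]] <-]; rewrite setTI.
by apply: open_measurable_Rd; apply: cf; exact: itv_open.
Qed.

(** The union of a near-optimal cover by open boxes is open, and the same cover bounds its
    measure. *)
Lemma outer_regular_Rd (A : set 'rV[R]_d) (e : R) : 0 < e -> (mu A < +oo)%E ->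
  exists O, [/\ open O, A `<=` O & (mu O <= mu A + e%:E)%E].
Proof.
move=> e0 Aoo; have [D [a [b [[ab AD] volA]]]] := lebesgue_outer_cover e0 Aoo.
exists (\bigcup_(k in D) box (a k) (b k)); split => //.
  by apply: bigcup_open => k _; exact: open_box.
apply: le_trans volA; apply: ereal_inf_lbound; exists D, a, b.
by split => //; split.
Qed.

(** Completeness of the Caratheodory measure: a set of outer measure 0 is itself measurable. It
    turns the hypothesis on [Sing] into an almost everywhere statement. *)
Lemma lebesgueRd_negligible (A : set T) : mu A = 0%E -> mu.-negligible A.
Proof.
move=> A0; exists A; split => //.
apply: le_caratheodory_measurable => X.
rewrite [Y in (Y + _ <= _)%E](_ : _ = 0%E); last first.
  apply/eqP; rewrite eq_le lebesgue_outer_ge0 andbT -A0.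
  exact: le_lebesgue_outer.
by rewrite add0e; exact: le_lebesgue_outer.
Qed.

End lebesgue_Rd_measurability.

(** * Musielak-Orlicz functions *)

Section musielak_orlicz_theory.
Context (R : realType) (d : nat) (Omega : set 'rV[R]_d).
Context (Phi : 'rV[R]_d -> R -> R).
Context (oOmega : open Omega) (moPhi : musielak_orlicz Omega Phi).
Local Notation mu := (@lebesgueRd R d).
Local Notation T := (lebesgueRdType R d).
Implicit Types (u v w h : 'rV[R]_d -> R) (x : 'rV[R]_d).

Let mOmega : measurable (Omega : set T).
Proof. exact: open_measurable_Rd. Qed.

Lemma Phi_ge0 x t : Omega x -> 0 <= t -> 0 <= Phi x t.
Proof. by case: moPhi => + _ _ _; apply. Qed.

Lemma Phi0 x : Omega x -> Phi x 0 = 0.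
Proof. by case: moPhi => _ _ + _ => /(_ x 0) H Ox; apply/H. Qed.

Lemma Phi_convex x l s t : Omega x -> 0 <= l <= 1 -> 0 <= s -> 0 <= t ->
  Phi x (l * s + (1 - l) * t) <= l * Phi x s + (1 - l) * Phi x t.
Proof.
move=> Ox /andP[l0 l1] s0 t0; case: moPhi => _ /(_ x Ox) + _ _.
by move=> /(_ (Itv01 l0 l1) s t); rewrite !inE /=; exact.
Qed.

(** Convexity between t and 0, where [Phi x] vanishes. Monotonicity and continuity at 0 both follow
    from this inequality. *)
Lemma Phi_scale x l t : Omega x -> 0 <= l <= 1 -> 0 <= t ->
  Phi x (l * t) <= l * Phi x t.
Proof.
move=> Ox l01 t0; have := Phi_convex Ox l01 t0 (lexx 0).
by rewrite mulr0 addr0 Phi0 // mulr0 addr0.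
Qed.

Lemma Phi_le x s t : Omega x -> 0 <= s -> s <= t -> Phi x s <= Phi x t.
Proof.
move=> Ox s0 st; have [t0|t0] := ltP 0 t; last first.
  by have -> : s = t by lra.
have l01 : 0 <= s / t <= 1.
  by rewrite divr_ge0 ?(ltW t0) //= ler_pdivrMr // mul1r.
have := Phi_scale Ox l01 (ltW t0); rewrite divfK ?gt_eqF // => /le_trans; apply.
have /andP[_ l1] := l01.
by rewrite ler_piMl // Phi_ge0 // ltW.
Qed.

Lemma Phi_cvg0 x (s : nat -> R) : Omega x -> (forall n, 0 <= s n) ->
  s n @[n --> \oo] --> 0 -> Phi x (s n) @[n --> \oo] --> 0.
Proof.
move=> Ox s0 scvg.
(* By convexity [Phi x s] is at most s * [Phi x 1] as soon as s <= 1. *)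
have sPhi : s n * Phi x 1 @[n --> \oo] --> 0.
  by rewrite -(mul0r (Phi x 1)); apply: cvgM => //; exact: cvg_cst.
apply: (@squeeze_cvgr _ _ _ _ (cst 0) (fun n => s n * Phi x 1)) => //;
  last exact: cvg_cst.
have s1 : \forall n \near \oo, s n < 1.
  by apply: (cvgr_lt _ scvg); exact: ltr01.
near=> n; apply/andP; split; first by rewrite Phi_ge0.
rewrite -[X in Phi x X]mulr1 Phi_scale //; apply/andP; split => //.
by apply: ltW; near: n.
Unshelve. all: by end_near. Qed.

(* Right continuity of [Phi x], which makes the infimum over the rational
   [q > t] equal to [Phi x t]. *)
Lemma Phi_lt_rat x t c : Omega x -> 0 <= t -> Phi x t < c ->
  exists2 q : rat, t < ratr q & Phi x (ratr q) < c.
Proof.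
move=> Ox t0 tc.
pose M := Phi x (t + 1); have M0 : 0 <= M by rewrite Phi_ge0 // addr_ge0.
(* Convexity on [t, t + 1] bounds the increment at q by (q - t) * M, and q - t < e makes (q - t) *
   (M + 1) less than c - [Phi x t]; the added 1 keeps the denominator positive. *)
pose e := Order.min 1 ((c - Phi x t) / (M + 1)).
have M10 : 0 < M + 1 by rewrite ltr_wpDl.
have e0 : 0 < e by rewrite lt_min ltr01 divr_gt0 // subr_gt0.
have te : t < t + e by rewrite ltrDl.
have [q] := rat_in_itvoo te; rewrite in_itv/= => /andP[tq qe].
exists q => //.
have qt1 : 0 <= ratr q - t <= 1.
  have : e <= 1 by rewrite ge_min lexx.
  by move=> ?; apply/andP; split; lra.
have := Phi_convex Ox qt1 (addr_ge0 t0 ler01) t0.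
have -> : (ratr q - t) * (t + 1) + (1 - (ratr q - t)) * t = ratr q :> R by ring.
move=> /le_lt_trans; apply.
rewrite -/M.
have h1 : (ratr q - t) * (M + 1) < c - Phi x t.
  rewrite -ltr_pdivlMr // (@lt_le_trans _ _ e) //; first by lra.
  by rewrite ge_min lexx orbT.
have h2 : 0 <= (ratr q - t) * Phi x t.
  by rewrite mulr_ge0 ?Phi_ge0 //; have /andP[] := qt1.
have /andP[h3 _] := qt1.
move: h1 h2 h3; lra.
Qed.

(** By monotonicity and right continuity, Phi(x, w(x)) < c holds exactly when some rational q > w(x)
    has Phi(x, q) < c; a sublevel set is thus a countable union of measurable sets. *)
Lemma measurable_Phi w : (forall x, Omega x -> 0 <= w x) ->
  measurable_fun (Omega : set T) w ->
  measurable_fun (Omega : set T) (fun x => Phi x (w x)).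
Proof.
move=> w0 mw; apply: (measurability _ (RGenInftyO.measurableE R)) => //.
move=> _ [_ [c ->] <-].
(* The absolute value of q gives an argument in [0, +oo[, where [Phi] is measurable in x; on the
   sets in question w < q already forces q > 0. *)
have -> : Omega `&` (fun x => Phi x (w x)) @^-1` `]-oo, c[%classic =
  \bigcup_(q : rat) ((Omega `&` w @^-1` `]-oo, (ratr q)[%classic) `&`
    (Omega `&` (Phi ^~ `|ratr q|) @^-1` `]-oo, c[%classic)).
  apply/seteqP; split => [x /= [Ox]|x [q _ [[Ox]]]]; rewrite /= !in_itv /=.
    move=> xc; have [q wq qc] := Phi_lt_rat Ox (w0 _ Ox) xc.
    exists q => //=; rewrite /= !in_itv /= wq ger0_norm ?qc //.
    by rewrite (le_trans (w0 _ Ox)) // ltW.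
  move=> wq [_] qc; split => //.
  apply: le_lt_trans qc; apply: Phi_le => //; first exact: w0.
  by rewrite (le_trans (ltW wq)) // ler_norm.
apply: bigcupT_measurable_rat => q; apply: measurableI; first exact: mw.
by case: moPhi => _ _ _; apply => //; exact: normr_ge0.
Qed.

Definition rmodular w : \bar R := (\int[mu]_(x in Omega) (Phi x `|w x|)%:E)%E.

Lemma measurable_Phi_norm w : measurable_fun (Omega : set T) w ->
  measurable_fun (Omega : set T) (fun x => (Phi x `|w x|)%:E).
Proof.
move=> mw; apply/measurable_EFinP; apply: measurable_Phi => //.
exact: measurableT_comp.
Qed.

Lemma le_rmodular u v : measurable_fun (Omega : set T) u ->
  measurable_fun (Omega : set T) v ->
  (forall x, Omega x -> `|u x| <= `|v x|) -> (rmodular u <= rmodular v)%E.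
Proof.
move=> mu_ mv uv; apply: ge0_le_integral => //.
- by move=> x Ox; rewrite lee_fin Phi_ge0.
- exact: measurable_Phi_norm.
- exact: measurable_Phi_norm.
- by move=> x Ox; rewrite lee_fin Phi_le // uv.
Qed.

(* Only the monotonicity of [Phi x] is needed, as [|w| <= max |u| |v|]. *)
Lemma rmodularD w u v : measurable_fun (Omega : set T) w ->
  measurable_fun (Omega : set T) u ->
  measurable_fun (Omega : set T) v ->
  (forall x, Omega x -> 2 * `|w x| <= `|u x| + `|v x|) ->
  (rmodular w <= rmodular u + rmodular v)%E.
Proof.
move=> mw mu_ mv wuv.
rewrite /rmodular -ge0_integralD //; last 4 first.
- by move=> x Ox; rewrite lee_fin Phi_ge0.
- exact: measurable_Phi_norm.
- by move=> x Ox; rewrite lee_fin Phi_ge0.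
- exact: measurable_Phi_norm.
apply: ge0_le_integral => //.
- by move=> x Ox; rewrite lee_fin Phi_ge0.
- exact: measurable_Phi_norm.
- by apply: emeasurable_funD; exact: measurable_Phi_norm.
move=> x Ox; rewrite -EFinD lee_fin.
have := wuv _ Ox; have [uv|vu] := leP `|u x|%R `|v x|%R => wx.
  apply: ler_wpDl; first by rewrite Phi_ge0.
  by apply: Phi_le => //; lra.
apply: ler_wpDr; first by rewrite Phi_ge0.
by apply: Phi_le => //; lra.
Qed.

Lemma rmodular_dominated (u : nat -> 'rV[R]_d -> R) h (e : R) : 0 < e ->
  (forall n, measurable_fun (Omega : set T) (u n)) ->
  measurable_fun (Omega : set T) h -> (rmodular h < +oo)%E ->
  (forall n x, Omega x -> `|u n x| <= `|h x|) ->
  {ae mu, forall x, Omega x -> u n x @[n --> \oo] --> 0} ->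
  exists n, (rmodular (u n) <= e%:E)%E.
Proof.
move=> e0 mu_ mh hoo uh u0.
have Phiu_cvg : {ae mu, forall x, Omega x ->
    ((Phi x `|u n x|)%:E)%E @[n --> \oo] --> 0%E}.
  move: u0; apply: filterS; first exact: (ae_filter_ringOfSetsType mu).
  move=> x xu Ox; apply: cvg_EFin; first exact: nearW.
  apply: (Phi_cvg0 Ox) => //.
  by rewrite -(normr0 R); apply: cvg_norm; exact: xu.
have inth : mu.-integrable Omega (fun x => (Phi x `|h x|)%:E).
  apply/integrableP; split; first exact: measurable_Phi_norm.
  rewrite (_ : (\int[_]_(_ in _) _)%E = rmodular h) //.
  by apply: eq_integral => x; rewrite inE => Ox;
    rewrite gee0_abs // lee_fin Phi_ge0.
have Phiuh : {ae mu, forall x n, Omega x ->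
    (`|(Phi x `|u n x|)%:E| <= (Phi x `|h x|)%:E)%E}.
  apply: aeW => x n Ox; rewrite gee0_abs ?lee_fin ?Phi_ge0 //.
  by rewrite Phi_le // uh.
have [_ _] := dominated_convergence mOmega
  (fun n => measurable_Phi_norm (mu_ n)) (measurable_cst _) Phiu_cvg inth Phiuh.
rewrite integral0 => /fine_cvgP [fin cvg0].
have near_e : \forall n \near \oo, fine (rmodular (u n)) < e.
  exact: (cvgr_lt _ cvg0).
have [N [fN eN]] := filter_ex (filterI fin near_e).
exists N; have fuN : rmodular (u N) \is a fin_num by exact: fN.
by rewrite -(fineK fuN) lee_fin ltW.
Qed.


End musielak_orlicz_theory.

(** * Smooth functions *)

Section flat_function.
Context (R : realType).
Implicit Types (P : {poly R}) (t : R).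

(* [flat 1 t = exp (- 1 / t)] for [t > 0]; polynomials in [1 / t] are needed as
   factors to be closed under derivation. *)
Definition flat P t : R := if 0 < t then P.[t^-1] * expR (- t^-1) else 0.

(** With s = 1 / t, the derivative in t of P(s) exp(-s) is s^2 (P(s) - P'(s)) exp(-s). *)
Definition flat_deriv P : {poly R} := 'X^2 * (P - P^`()).

Lemma flatX P t : flat ('X * P) t = t^-1 * flat P t.
Proof.
by rewrite /flat; case: ifP => _; rewrite ?mulr0 // hornerM hornerX mulrA.
Qed.

Lemma exprn_le_expR (n : nat) t : 0 <= t -> t ^+ n <= n`!%:R * expR t.
Proof.
move=> t0; case: n => [|n]; first by rewrite expr0 mul1r -expR0 ler_expR.
rewrite mulrC -ler_pdivrMr ?ltr0n ?fact_gt0 //.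
by apply: le_trans (expR_ge1Dxn n t0); rewrite lerDr.
Qed.

(** Each power (1 / t)^i is at most i! exp(1 / t), and the factor exp(-1 / t) cancels the
    exponential. *)
Lemma flat_bounded P : exists2 C, 0 <= C & forall t, `|flat P t| <= C.
Proof.
exists (\sum_(i < size P) `|P`_i| * i`!%:R).
  by apply: sumr_ge0 => i _; rewrite mulr_ge0.
move=> t; rewrite /flat; case: ifPn => [t0|_]; last first.
  by rewrite normr0 sumr_ge0 // => i _; rewrite mulr_ge0.
rewrite normrM (ger0_norm (expR_ge0 _)) expRN ler_pdivrMr ?expR_gt0 //.
rewrite horner_coef (le_trans (ler_norm_sum _ _ _)) // mulr_suml.
apply: ler_sum => i _; rewrite normrM -mulrA ler_wpM2l //.
have ti0 : 0 <= t^-1 by rewrite invr_ge0 ltW.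
by rewrite ger0_norm ?exprn_ge0 // exprn_le_expR.
Qed.

(** For t != 0, [flat P t] is t times [flat ('X * P) t], and the latter is bounded. *)
Lemma flat_cvg0 P : flat P t @[t --> 0^'] --> 0.
Proof.
have [C C0 CP] := flat_bounded ('X * P).
have tC : `|t| * C @[t --> (0 : R)^'] --> 0.
  rewrite -[X in _ --> X](mul0r C); apply: cvgM; last exact: cvg_cst.
  rewrite -[X in _ --> X](normr0 R); apply: cvg_norm.
  by apply: cvg_within_filter; exact: cvg_id.
apply/norm_cvg0P; apply: (@squeeze_cvgr _ _ _ _ (cst 0) (fun t => `|t| * C)).
- near=> t; rewrite normr_ge0 /=.
  have t0 : t != 0 by near: t; exact: nbhs_dnbhs_neq.
  rewrite -[flat P t](mulVKf t0) -flatX normrM.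
  by rewrite ler_wpM2l.
- exact: cvg_cst.
- exact: tC.
Unshelve. all: by end_near. Qed.

Lemma is_derive_flat P t : is_derive t 1 (flat P) (flat (flat_deriv P) t).
Proof.
have [t0|t0|<-] := ltgtP 0 t.
- have -> : flat (flat_deriv P) t =
     P^`().[t^-1] * (- t ^- 2) * expR (- t^-1)
     + P.[t^-1] * (expR (- t^-1) * t ^- 2).
    rewrite /flat t0 /flat_deriv !hornerE exprVn /=; ring.
  have dV : is_derive t 1 (fun s : R => s^-1) (- t ^- 2 *: 1).
    by apply: (@is_deriveV _ id); rewrite // gt_eqF.
  have dP := is_derive1_comp (is_derive_poly P t^-1) dV.
  have dE : is_derive t 1 (expR \o (fun s : R => - s^-1))
      (expR (- t^-1) * (- (- t ^- 2 *: 1))).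
    by apply: is_derive1_comp; exact: is_deriveN.
  apply: (@near_eq_is_derive _ _ _
    ((horner P \o (fun s : R => s^-1)) * (expR \o (fun s : R => - s^-1)))).
    near=> s; rewrite /flat ifT //.
    by near: s; exact: lt_nbhsr.
  apply: is_derive_eq (is_deriveM dP dE) _ => /=.
  rewrite /GRing.scale /= ; ring.
- rewrite {2}/flat ltNge (ltW t0) /=.
  apply: (@near_eq_is_derive _ _ _ (cst 0)).
  near=> s; rewrite /flat ifF //; apply/negbTE; rewrite -leNgt ltW //.
  by near: s; exact: lt_nbhsl.
(* At 0 the difference quotient of [flat P] is [flat ('X * P)], which tends to 0. *)
- rewrite {2}/flat ltxx.
  have d0 : h^-1 *: ((flat P \o shift 0) (h *: 1) - flat P 0) @[h --> 0^'] -->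
      (0 : R).
    rewrite [X in X @ _](_ : _ = flat ('X * P)); first exact: flat_cvg0.
    apply/funext => h; rewrite flatX /= {2}/flat ltxx subr0 addr0.
    by rewrite [h *: 1]mulr1.
  by apply: DeriveDef; [apply/cvg_ex; exists 0|apply/cvg_lim].
Unshelve. all: by end_near. Qed.

Lemma continuous_flat P : continuous (flat P).
Proof.
move=> t; apply/differentiable_continuous/derivable1_diffP.
exact: (@ex_derive _ _ _ _ _ _ _ (is_derive_flat P t)).
Qed.

Lemma flat1_gt0 t : (0 < flat 1 t) = (0 < t).
Proof.
by rewrite /flat; case: ifP => t0; rewrite ?ltxx // hornerC mul1r expR_gt0.
Qed.

Lemma flat1_01 t : 0 <= flat 1 t <= 1.
Proof.
rewrite /flat; case: ifP => t0; rewrite ?lexx ?ler01 //.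
by rewrite hornerC mul1r expR_ge0 expR_le1 oppr_le0 invr_ge0 ltW.
Qed.

Lemma le_flat1 s t : s <= t -> flat 1 s <= flat 1 t.
Proof.
move=> st; rewrite {1}/flat; case: ifP => s0; last by have /andP[] := flat1_01 t.
have t0 := lt_le_trans s0 st.
by rewrite /flat t0 !hornerC !mul1r ler_expR lerN2 lef_pV2.
Qed.

End flat_function.

(** * Closure properties of the classes C^k *)

Section smooth_calculus.
Context (R : realType) (d : nat).
Implicit Types (u v : 'rV[R]_d -> R) (k : nat).

Lemma classC_continuous k u : classC k u -> continuous u.
Proof. by case: k => [|k] []. Qed.

Lemma classC_weaken k u : classC k.+1 u -> classC k u.
Proof.
elim: k u => [|k IH] u; first by case.
by case=> cu du; split=> // i; have [? ?] := du i; split => //; exact: IH.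
Qed.

Lemma classC_cst k (c : R) : classC k ((fun=> c) : 'rV[R]_d -> R).
Proof.
elim: k c => [|k IH] c; first by split=> //; exact: cst_continuous.
split; first exact: cst_continuous.
move=> i; split=> [x|]; first exact: derivable_cst.
rewrite [X in classC _ X](_ : _ = (fun=> 0)); first exact: IH.
by apply/funext => x; exact: derive_cst.
Qed.

Lemma classCD k u v : classC k u -> classC k v -> classC k (fun x => u x + v x).
Proof.
elim: k u v => [|k IH] u v [cu du] [cv dv].
  split=> // x; exact: (continuousD (cu x) (cv x)).
split=> [x|i]; first by exact: (continuousD (cu x) (cv x)).
have [dui cui] := du i; have [dvi cvi] := dv i.
split=> [x|]; first by apply: derivableD; [exact: dui|exact: dvi].
rewrite [X in classC _ X](_ : _ = (fun x => 'D_(delta_mx ord0 i) u x +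
    'D_(delta_mx ord0 i) v x)); first exact: IH.
by apply/funext => x; rewrite -deriveD.
Qed.

Lemma classCM k u v : classC k u -> classC k v -> classC k (fun x => u x * v x).
Proof.
elim: k u v => [|k IH] u v Cu Cv; have [cu du] := Cu; have [cv dv] := Cv.
  by split => // x; exact: (continuousM (cu x) (cv x)).
split=> [x|i]; first by exact: (continuousM (cu x) (cv x)).
have [dui cui] := du i; have [dvi cvi] := dv i.
split=> [x|]; first by apply: derivableM; [exact: dui|exact: dvi].
rewrite [X in classC _ X](_ : _ = (fun x => u x * 'D_(delta_mx ord0 i) v x +
    v x * 'D_(delta_mx ord0 i) u x)).
  by apply: classCD; apply: IH => //; exact: classC_weaken.
by apply/funext => x; rewrite -[RHS]deriveM.
Qed.

Lemma classC_prod k (I : Type) (s : seq I) (u : I -> 'rV[R]_d -> R) :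
  (forall i, classC k (u i)) -> classC k (fun x => \prod_(i <- s) u i x).
Proof.
move=> Cu; elim: s => [|i s IH].
  by rewrite [X in classC _ X](_ : _ = (fun=> 1));
    [exact: classC_cst|apply/funext => x; rewrite big_nil].
rewrite [X in classC _ X](_ : _ = (fun x => u i x * \prod_(j <- s) u j x)).
  exact: classCM.
by apply/funext => x; rewrite big_cons.
Qed.

Lemma classC_onem k u : classC k u -> classC k (fun x => 1 - u x).
Proof.
move=> Cu; rewrite [X in classC _ X](_ : _ = (fun x => 1 + (-1) * u x)).
  by apply: classCD; [exact: classC_cst|apply: classCM => //; exact: classC_cst].
by apply/funext => x; rewrite mulN1r.
Qed.

Lemma classCX k u n : classC k u -> classC k (fun x => u x ^+ n).
Proof.
move=> Cu; elim: n => [|n IH].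
  by rewrite [X in classC _ X](_ : _ = (fun=> 1));
    [exact: classC_cst|apply/funext => x; rewrite expr0].
rewrite [X in classC _ X](_ : _ = (fun x => u x * u x ^+ n)).
  exact: classCM.
by apply/funext => x; rewrite exprS.
Qed.

(** Along the direction j the argument is the affine function s x_i + c + m h of the step h, where m
    is s if i = j and 0 otherwise, so the one-variable chain rule applies at h = 0. *)
Lemma is_derive_flat_coord (P : {poly R}) (i j : 'I_d) (s c : R) x :
  is_derive x (delta_mx ord0 j) (fun y : 'rV[R]_d => flat P (s * y ord0 i + c))
    ((s * (i == j)%:R) * flat (flat_deriv P) (s * x ord0 i + c)).
Proof.
pose m := s * (i == j)%:R.
have dg : is_derive (0 : R) 1
    (flat P \o (fun h : R => s * x ord0 i + c + m * h))
    (flat (flat_deriv P) (s * x ord0 i + c + m * 0) * m).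
  apply: is_derive1_comp; first exact: is_derive_flat.
  have h1 : is_derive (0 : R) 1 (cst (s * x ord0 i + c) + m \*: (id : R -> R))
      (0 + m *: 1).
    apply: is_deriveD.
  apply: is_derive_eq h1 _; by rewrite add0r [m *: 1]mulr1.
have E : (fun h : R => h^-1 *: (((fun y : 'rV[R]_d => flat P (s * y ord0 i + c))
      \o shift x) (h *: delta_mx ord0 j) - flat P (s * x ord0 i + c))) =
   (fun h : R => h^-1 *: (((flat P \o (fun h : R => s * x ord0 i + c + m * h))
      \o shift 0) (h *: 1) -
      (flat P \o (fun h : R => s * x ord0 i + c + m * h)) 0)).
  apply/funext => h /=; rewrite !mxE eqxx /= mulr0 !addr0 [h *: 1]mulr1.
  congr (_ *: (flat P _ - _)); rewrite /m (eq_sym i j); ring.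
case: dg; rewrite mulr0 addr0 => exg dg.
apply: DeriveDef; rewrite /derivable /derive.
  by rewrite E; exact: exg.
by rewrite E -/m [RHS]mulrC; exact: dg.
Qed.

(** The induction on k treats all polynomials at once: differentiating only replaces P by
    [flat_deriv P] and multiplies by a constant. *)
Lemma classC_flat_coord k (P : {poly R}) (i : 'I_d) (s c : R) :
  classC k (fun x => flat P (s * x ord0 i + c)).
Proof.
have cf Q : continuous (fun x : 'rV[R]_d => flat Q (s * x ord0 i + c)).
  move=> x; apply: (@continuous_comp _ _ _ (fun x : 'rV[R]_d => s * x ord0 i + c)
    (flat Q)); last exact: continuous_flat.
  apply: (@continuousD _ _ _ (fun x : 'rV[R]_d => s * x ord0 i) (cst c));
    last exact: cst_continuous.
  apply: (@continuousM _ _ (cst s) (fun x : 'rV[R]_d => x ord0 i));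
    [exact: cst_continuous|exact: coord_continuous].
elim: k P => [|k IH] P; first by split.
split=> [//|j]; split=> [x|].
  exact: (@ex_derive _ _ _ _ _ _ _ (is_derive_flat_coord P i j s c x)).
rewrite [X in classC _ X](_ : _ = (fun x : 'rV[R]_d =>
    (s * (i == j)%:R) * flat (flat_deriv P) (s * x ord0 i + c))).
  by apply: classCM; [exact: classC_cst|exact: IH].
apply/funext => x.
exact: (@derive_val _ _ _ _ _ _ _ (is_derive_flat_coord P i j s c x)).
Qed.

End smooth_calculus.

(** * Smooth approximation of indicators of open sets *)

Section smooth_approximation.
Context (R : realType) (d : nat).
Implicit Types (O : set 'rV[R]_d) (u : 'rV[R]_d -> R) (a b x : 'rV[R]_d).

Definition csupported O u : Prop :=
  exists K, [/\ compact K, K `<=` O & forall x, ~ K x -> u x = 0].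

(** As [csupported] forces the value 0 off O, such a sequence tends everywhere to the indicator of O
    and is dominated by it. *)
Definition smooth_approx O (q : nat -> 'rV[R]_d -> R) : Prop :=
  [/\ (forall n k, classC k (q n)), (forall n x, 0 <= q n x <= 1),
      (forall n, csupported O (q n)) &
      (forall x, O x -> q n x @[n --> \oo] --> (1 : R))].

Lemma csupported_eq0 O u x : csupported O u -> ~ O x -> u x = 0.
Proof. by case=> K [_ KO uK] Ox; apply: uK => /KO. Qed.

Lemma smooth_approx0 : smooth_approx set0 (fun _ _ => 0).
Proof.
split=> [n k|n x|n|x] //; first exact: classC_cst.
  by rewrite lexx ler01.
by exists set0; split => //; exact: compact0.
Qed.

(** Positive exactly on the box shrunk by e on every side. The coefficients 1 and -1 are spelled out
    to match the affine form in [classC_flat_coord]. *)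
Let bump a b (e : R) x : R := \prod_(i < d)
  (flat 1 (1 * x ord0 i + (- a ord0 i - e)) *
   flat 1 (-1 * x ord0 i + (b ord0 i - e))).

Let bump_01 a b e x : 0 <= bump a b e x <= 1.
Proof.
apply/andP; split.
  apply: prodr_ge0 => i _.
  by rewrite mulr_ge0 //;
    [have /andP[] := flat1_01 (1 * x ord0 i + (- a ord0 i - e))|
     have /andP[] := flat1_01 (-1 * x ord0 i + (b ord0 i - e))].
apply: prodr_ile1 => i _.
have /andP[h1 h2] := flat1_01 (1 * x ord0 i + (- a ord0 i - e)).
have /andP[h3 h4] := flat1_01 (-1 * x ord0 i + (b ord0 i - e)).
by rewrite mulr_ge0 //= mulr_ile1.
Qed.

Let le_bump a b e e' x : e' <= e -> bump a b e x <= bump a b e' x.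
Proof.
move=> ee; apply: ler_prod => i _.
have /andP[h1 _] := flat1_01 (1 * x ord0 i + (- a ord0 i - e)).
have /andP[h3 _] := flat1_01 (-1 * x ord0 i + (b ord0 i - e)).
by rewrite mulr_ge0 //= ler_pM // le_flat1 //; lra.
Qed.

(* [1 - (1 - bump)^n] tends to 1 as soon as [bump] stays above some [c > 0]. *)
Lemma smooth_approx_box a b : exists q, smooth_approx (box a b) q.
Proof.
pose e n : R := n.+1%:R^-1.
have e0 n : 0 < e n by rewrite invr_gt0 ltr0n.
exists (fun n x => 1 - (1 - bump a b (e n) x) ^+ n); split.
- move=> n k; apply/classC_onem/classCX/classC_onem.
  by apply: classC_prod => i; apply: classCM; exact: classC_flat_coord.
- move=> n x; have /andP[h1 h2] := bump_01 a b (e n) x.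
  have h : 0 <= (1 - bump a b (e n) x) ^+ n <= 1.
    by rewrite exprn_ge0 ?exprn_ile1 //=; lra.
  by have /andP[h3 h4] := h; apply/andP; split; lra.
- move=> n; exists [set x : 'rV[R]_d | forall i,
      `[a ord0 i + e n, b ord0 i - e n]%classic (x ord0 i)]; split.
  + by apply: (@rV_compact _ _ (fun i =>
      `[a ord0 i + e n, b ord0 i - e n]%classic)) => i; exact: segment_compact.
  + move=> x xK i; have := xK i; rewrite /= in_itv /= => /andP[h1 h2].
    by have := e0 n; move=> ?; apply/andP; split; lra.
  + move=> x /existsNP[i /negP]; rewrite in_itv /=.
    rewrite negb_and -!ltNge => xi.
    have -> : bump a b (e n) x = 0; last first.
      by rewrite subr0 expr1n subrr.
    apply/eqP/prodf_eq0; exists i => //; rewrite mulf_eq0 /flat.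
    case/orP: xi => xi; apply/orP; [left|right]; rewrite ifF //; lra.
move=> x abx.
have [N _ NP] : \forall n \near \oo, forall i : 'I_d,
    e n < x ord0 i - a ord0 i /\ e n < b ord0 i - x ord0 i.
  apply: filter_forall => i; have /andP[ax xb] := abx i.
  apply: filterI.
    by apply: (cvgr_lt _ (@cvg_harmonic R)); rewrite subr_gt0.
  by apply: (cvgr_lt _ (@cvg_harmonic R)); rewrite subr_gt0.
(* The index N depends on x. As [bump] grows when its margin shrinks, it is at least c for all n >=
   N, so (1 - [bump])^n is at most (1 - c)^n. *)
pose c := bump a b (e N) x.
have c0 : 0 < c.
  apply: prodr_gt0 => i _; have [h1 h2] := NP N (leqnn N) i.
  by rewrite mulr_gt0 // flat1_gt0; lra.
have /andP[_ c1] := bump_01 a b (e N) x.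
rewrite -[X in _ --> X]subr0; apply: cvgB; first exact: cvg_cst.
apply: (@squeeze_cvgr _ _ _ _ (cst 0) (GRing.exp (1 - c))).
- near=> n; have /andP[p0 p1] := bump_01 a b (e n) x.
  rewrite exprn_ge0 ?subr_ge0 //= lerXn2r ?nnegrE ?subr_ge0 //.
  rewrite lerD2l lerN2 le_bump // lef_pV2 ?posrE ?ltr0n // ler_nat ltnS.
  by near: n; exact: nbhs_infty_ge.
- exact: cvg_cst.
- by apply: cvg_expr; rewrite ger0_norm; rewrite -/c in c1; lra.
Unshelve. all: by end_near. Qed.

(** One minus the product of the 1 - q_m over the first n rational boxes inside O is a smooth
    analogue of the indicator of their union: its support stays compact, and it dominates every q_m
    with m < n. *)
Lemma smooth_approx_open O : open O -> exists q, smooth_approx O q.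
Proof.
move=> oO.
pose B m := if pselect (@ratbox R d m `<=` O) then @ratbox R d m else set0.
have BO m : B m `<=` O.
  by rewrite /B; case: pselect => [|?] //=; exact: sub0set.
have /choice[q qP] : forall m, exists q, smooth_approx (B m) q.
  move=> m; rewrite /B; case: pselect => ? /=.
    by have [[a [b ->]]|->] := @ratboxP R d m;
      [exact: smooth_approx_box|exists (fun _ _ => 0); exact: smooth_approx0].
  by exists (fun _ _ => 0); exact: smooth_approx0.
have q01 m n x : 0 <= q m n x <= 1 by have [_ + _ _] := qP m; apply.
have r01 m n x : 0 <= 1 - q m n x <= 1.
  by have /andP[? ?] := q01 m n x; apply/andP; split; lra.
have prod01 s n x : 0 <= \prod_(m <- s) (1 - q m n x) <= 1.
  apply/andP; split; last by apply: prodr_ile1.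
  by apply: prodr_ge0 => m _; have /andP[] := r01 m n x.
exists (fun n x => 1 - \prod_(m <- iota 0 n) (1 - q m n x)); split.
- move=> n k; apply/classC_onem/classC_prod => m; apply/classC_onem.
  by have [+ _ _ _] := qP m; apply.
- move=> n x; have /andP[? ?] := prod01 (iota 0 n) n x.
  by apply/andP; split; lra.
- move=> n.
  have /choice[K KP] : forall m, exists K,
      [/\ compact K, K `<=` B m & forall x, ~ K x -> q m n x = 0].
    by move=> m; have [_ _ + _] := qP m; apply.
  exists (\big[setU/set0]_(m <- iota 0 n) K m); split.
  + by apply: bigsetU_compact => m _; have [] := KP m.
  + rewrite -bigcup_seq => x [m _ Kx]; apply: (BO m).
    by have [_ + _] := KP m; apply.
  + move=> x; rewrite -bigcup_seq => Kx; rewrite big1_seq ?subrr //.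
    move=> m /andP[_ mn].
    have [_ _ ->] := KP m; first by rewrite subr0.
    by move=> Kmx; apply: Kx; exists m.
move=> x Ox; have [m mx mO] := open_ratbox_nbhs oO Ox.
have Bmx : B m x by rewrite /B; case: pselect.
have [_ _ _ /(_ x Bmx) qm] := qP m.
apply: (@squeeze_cvgr _ _ _ _ (q m ^~ x) (cst 1)) => //; last exact: cvg_cst.
near=> n; have /andP[p0 p1] := prod01 (iota 0 n) n x.
apply/andP; split; last by rewrite /=; lra.
have mn : m \in iota 0 n.
  by rewrite mem_iota /= add0n; near: n; exact: nbhs_infty_gt.
rewrite (big_rem _ mn) /= lerBrDr -lerBrDl.
have /andP[h0 h1] := r01 m n x.
have /andP[h2 h3] := prod01 (rem m (iota 0 n)) n x.
by rewrite ler_piMr.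
Unshelve. all: by end_near. Qed.

End smooth_approximation.

(** * Approximation by smooth functions in the modular *)

Section approximable_functions.
Context (R : realType) (d : nat) (Omega : set 'rV[R]_d).
Context (Phi : 'rV[R]_d -> R -> R).
Context (oOmega : open Omega) (moPhi : musielak_orlicz Omega Phi).
Local Notation mu := (@lebesgueRd R d).
Local Notation T := (lebesgueRdType R d).
Local Notation J := (rmodular Omega Phi).
Implicit Types (u v w h g : 'rV[R]_d -> R) (x : 'rV[R]_d).

Let mOmega : measurable (Omega : set T).
Proof. exact: open_measurable_Rd. Qed.

(* The real-valued functions of E^Phi. *)
Definition finite_modulars u : Prop :=
  measurable_fun (Omega : set T) u /\
  forall l, 0 < l -> (J (fun x => l * u x)%R < +oo)%E.

(** The dilation l is arbitrary, so that a small modular gives a small norm. Finite modulars of g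
    are demanded because a smooth function with compact support in Omega may fail to lie in E^Phi
    near singular points. *)
Definition approximable u : Prop :=
  measurable_fun (Omega : set T) u /\
  forall l e : R, 0 < l -> 0 < e -> exists g,
    [/\ forall k, classC k g, csupported Omega g, finite_modulars g &
        (J (fun x => l * (u x - g x))%R <= e%:E)%E].

Let measurable_scale l u : measurable_fun (Omega : set T) u ->
  measurable_fun (Omega : set T) (fun x => l * u x).
Proof. by move=> mu_; exact: measurable_funM. Qed.

Lemma finite_modulars_le u v : finite_modulars v ->
  measurable_fun (Omega : set T) u ->
  (forall x, Omega x -> `|u x| <= `|v x|) -> finite_modulars u.
Proof.
move=> [mv vJ] mu_ uv; split => // l l0.
apply: le_lt_trans (vJ l l0); apply: (le_rmodular oOmega moPhi).
- exact: measurable_scale.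
- exact: measurable_scale.
- by move=> x Ox; rewrite !normrM ler_wpM2l // uv.
Qed.

Lemma finite_modularsD u v : finite_modulars u -> finite_modulars v ->
  finite_modulars (fun x => u x + v x).
Proof.
move=> [mu_ uJ] [mv vJ]; split; first exact: measurable_funD.
move=> l l0; have l20 : 0 < 2 * l by rewrite mulr_gt0.
apply: le_lt_trans (lte_add_pinfty (uJ _ l20) (vJ _ l20)).
apply: (rmodularD oOmega moPhi).
- exact/measurable_scale/measurable_funD.
- exact: measurable_scale.
- exact: measurable_scale.
move=> x Ox; rewrite !normrM !(ger0_norm (ltW l0)) (ger0_norm (ler0n _ 2)).
by rewrite mulrA -mulrDr ler_wpM2l ?(ltW l20) // ler_normD.
Qed.

Lemma finite_modularsZ c u : finite_modulars u ->
  finite_modulars (fun x => c * u x).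
Proof.
move=> [mu_ uJ]; split; first exact: measurable_scale.
(* The dilation must be positive even when c = 0, hence |c| + 1. *)
move=> l l0; have l1 : 0 < l * (`|c| + 1) by rewrite mulr_gt0 // ltr_wpDl.
apply: le_lt_trans (uJ _ l1); apply: (le_rmodular oOmega moPhi).
- exact/measurable_scale/measurable_scale.
- exact: measurable_scale.
move=> x Ox; rewrite !normrM -mulrA ler_wpM2l // ler_wpM2r //.
by rewrite [leRHS]ger0_norm ?lerDl // addr_ge0.
Qed.

Lemma approximableD u v : approximable u -> approximable v ->
  approximable (fun x => u x + v x).
Proof.
move=> [mu_ ua] [mv va]; split; first exact: measurable_funD.
move=> l e l0 e0.
have l20 : 0 < 2 * l by rewrite mulr_gt0.
have e20 : 0 < e / 2 by rewrite divr_gt0.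
have [g [Cg sg fg Jg]] := ua _ _ l20 e20.
have [h [Ch sh fh Jh]] := va _ _ l20 e20.
exists (fun x => g x + h x); split.
- by move=> k; exact: classCD.
- have [K [cK KO gK]] := sg; have [L [cL LO hL]] := sh.
  exists (K `|` L); split; first exact: compactU.
    by move=> x [/KO|/LO].
  move=> x /not_orP[Kx Lx]; by rewrite gK // hL // addr0.
- exact: finite_modularsD.
have [mg _] := fg; have [mh _] := fh.
have -> : e = e / 2 + e / 2 by rewrite -splitr.
rewrite EFinD; apply: le_trans (leeD Jg Jh).
apply: (rmodularD oOmega moPhi).
- by apply/measurable_scale/measurable_funB; exact: measurable_funD.
- exact/measurable_scale/measurable_funB.
- exact/measurable_scale/measurable_funB.
move=> x Ox; rewrite !normrM !(ger0_norm (ltW l0)) (ger0_norm (ler0n _ 2)).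
rewrite mulrA -mulrDr ler_wpM2l ?(ltW l20) // (le_trans _ (ler_normD _ _)) //.
by rewrite addrACA opprD.
Qed.

Lemma approximableZ c u : approximable u -> approximable (fun x => c * u x).
Proof.
move=> [mu_ ua]; split; first exact: measurable_scale.
move=> l e l0 e0; have l1 : 0 < l * (`|c| + 1) by rewrite mulr_gt0 // ltr_wpDl.
have [g [Cg sg fg Jg]] := ua _ _ l1 e0.
exists (fun x => c * g x); split.
- by move=> k; apply: classCM => //; exact: classC_cst.
- have [K [cK KO gK]] := sg; exists K; split => // x Kx.
  by rewrite gK // mulr0.
- exact: finite_modularsZ.
have [mg _] := fg.
apply: le_trans Jg; apply: (le_rmodular oOmega moPhi).
- by apply/measurable_scale/measurable_funB; exact: measurable_scale.
- exact/measurable_scale/measurable_funB.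
move=> x Ox; rewrite -mulrBr !normrM -mulrA ler_wpM2l // ler_wpM2r //.
by rewrite [leRHS]ger0_norm ?lerDl // addr_ge0.
Qed.

Lemma approximable_smooth g : (forall k, classC k g) -> csupported Omega g ->
  finite_modulars g -> approximable g.
Proof.
move=> Cg sg fg; split => [|l e l0 e0]; first by case: fg.
exists g; split => //.
rewrite [leLHS](_ : _ = 0%E) ?lee_fin ?ltW // /rmodular integral0_eq //.
by move=> x Ox; rewrite subrr mulr0 normr0 (Phi0 moPhi).
Qed.

(** Dominated convergence yields n with [un n] close to u, and then a smooth approximant of [un n]
    serves for u; the two errors add up by [rmodularD]. *)
Lemma approximable_cvg (un : nat -> 'rV[R]_d -> R) u h :
  (forall n, approximable (un n)) -> measurable_fun (Omega : set T) u ->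
  finite_modulars h ->
  (forall n x, Omega x -> `|un n x| <= h x) ->
  (forall x, Omega x -> `|u x| <= h x) ->
  {ae mu, forall x, Omega x -> un n x @[n --> \oo] --> u x} ->
  approximable u.
Proof.
move=> una mu_ [mh hJ] unh uh unu; split => // l e l0 e0.
have l20 : 0 < 2 * l by rewrite mulr_gt0.
(* The factor 2 in 2 * l is the cost of [rmodularD], and |2 l (u - un)| is then dominated by 4 l
   h. *)
have l40 : 0 < 4 * l by rewrite mulr_gt0.
have e20 : 0 < e / 2 by rewrite divr_gt0.
have mun n : measurable_fun (Omega : set T) (un n) by case: (una n).
have [n Jn] : exists n,
    (J (fun x => (2 * l) * (u x - un n x))%R <= (e / 2)%:E)%E.
  apply: (@rmodular_dominated _ _ _ _ oOmega moPhi
    (fun n x => (2 * l) * (u x - un n x)) (fun x => (4 * l) * h x) (e / 2) e20).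
  - by move=> n; exact/measurable_scale/measurable_funB.
  - exact: measurable_scale.
  - exact: hJ.
  - move=> n x Ox; rewrite !normrM !(ger0_norm (ltW l0)).
    rewrite !(ger0_norm (ler0n _ _)).
    have := ler_normB (u x) (un n x); have := unh n x Ox; have := uh x Ox.
    have := ler_norm (h x) => h1 h2 h3 h4.
    rewrite -!mulrA (mulrCA _ l) (mulrCA _ l) ler_wpM2l ?(ltW l0) //; lra.
  move: unu; apply: filterS; first exact: (ae_filter_ringOfSetsType mu).
  move=> x unx Ox; rewrite -(mulr0 (2 * l)); apply: cvgM; first exact: cvg_cst.
  rewrite -(subrr (u x)); apply: cvgB; first exact: cvg_cst.
  exact: unx.
have [_ una'] := una n.
have [g [Cg sg fg Jg]] := una' _ _ l20 e20.
exists g; split => //.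
have [mg _] := fg.
have -> : e = e / 2 + e / 2 by rewrite -splitr.
rewrite EFinD; apply: le_trans (leeD Jn Jg).
apply: (rmodularD oOmega moPhi).
- exact/measurable_scale/measurable_funB.
- exact/measurable_scale/measurable_funB.
- exact/measurable_scale/measurable_funB.
move=> x Ox; rewrite !normrM !(ger0_norm (ltW l0)) (ger0_norm (ler0n _ 2)).
rewrite mulrA -mulrDr ler_wpM2l ?(ltW l20) // (le_trans _ (ler_normD _ _)) //.
by rewrite addrA subrK.
Qed.

Lemma measurable_indic_Rd (A : set T) (D : set T) : measurable A ->
  measurable_fun D (\1_A : T -> R).
Proof. by move=> mA; apply: measurable_funTS; exact: measurable_indic. Qed.

Let norm_indic (A : set 'rV[R]_d) x : `|\1_A x : R| = \1_A x.
Proof. by rewrite ger0_norm // indicE ler0n. Qed.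

Lemma approximable_open (O : set 'rV[R]_d) : open O -> O `<=` Omega ->
  finite_modulars \1_O -> approximable \1_O.
Proof.
move=> oO OOmega fO; have [q [Cq q01 sq qcvg]] := smooth_approx_open oO.
have qO n x : `|q n x| <= \1_O x.
  have /andP[q0 q1] := q01 n x; rewrite ger0_norm // indicE.
  case: (boolP (x \in O)) => //.
  by rewrite notin_setE => /(csupported_eq0 (sq n)) ->.
have mq n : measurable_fun (Omega : set T) (q n).
  apply: measurable_funTS; apply: continuous_measurable_Rd.
  exact: (classC_continuous (Cq n 0%N)).
apply: (@approximable_cvg q _ \1_O) => //.
- move=> n; apply: approximable_smooth => //.
    have [K [cK KO qK]] := sq n; exists K; split => //.
    exact: subset_trans OOmega.
  by apply: (finite_modulars_le fO) => // x Ox; rewrite norm_indic.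
- by case: fO.
- by move=> x Ox; rewrite norm_indic.
apply: aeW => x Ox; rewrite indicE; case: (boolP (x \in O)) => [|].
  by rewrite inE; exact: qcvg.
rewrite notin_setE => nOx.
rewrite (_ : q ^~ x = cst 0); first exact: cvg_cst.
by apply/funext => n; exact: (csupported_eq0 (sq n)).
Qed.

(** The open sets W n given by outer regularity are cut down to V, whose indicator serves as the
    majorant, and intersected successively so that indicators converge off a null set. *)
Lemma approximable_indic (A V : set 'rV[R]_d) :
  open V -> V `<=` Omega -> finite_modulars \1_V ->
  measurable (A : set T) -> A `<=` V -> (mu A < +oo)%E -> approximable \1_A.
Proof.
move=> oV VOmega fV mA AV Afin.
have /choice[W WP] : forall n : nat, exists W, [/\ open W, A `<=` W &
    (mu W <= mu A + (n.+1%:R^-1)%:E)%E].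
  by move=> n; apply: outer_regular_Rd => //; rewrite invr_gt0 ltr0n.
have mW n : measurable (W n : set T).
  by apply: open_measurable_Rd; have [] := WP n.
pose Z k := V `&` \big[setI/setT]_(i <- iota 0 k) W i.
have oZ k : open (Z k).
  apply: openI => //; elim/big_ind: _ => //; [exact: openT|exact: openI|].
  by move=> i _; have [] := WP i.
have ZV k : Z k `<=` V by move=> x [].
have AZ k : A `<=` Z k.
  move=> x Ax; split; first exact: AV.
  by rewrite -bigcap_seq => i _; have [_ + _] := WP i; apply.
have indic_le (B : set 'rV[R]_d) x : B `<=` V -> `|\1_B x| <= \1_V x :> R.
  move=> BV; rewrite norm_indic !indicE ler_nat.
  case: (boolP (x \in B)) => //; rewrite inE => /BV Vx.
  by rewrite mem_set.
apply: (@approximable_cvg (fun k => \1_(Z k)) _ \1_V) => //.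
- move=> k; apply: approximable_open => //; first exact: subset_trans VOmega.
  apply: (finite_modulars_le fV).
    exact/measurable_indic_Rd/open_measurable_Rd.
  by move=> x Ox; rewrite [leRHS]norm_indic; exact: indic_le.
- by move=> k x _; exact: indic_le.
- by move=> x _; exact: indic_le.
(* Convergence can fail only on N: points of A give the constant 1, and a point missed by some W i
   gives 0 from k = i + 1 on. N is null because it lies in each W n minus A, of measure at most 1 /
   (n + 1). *)
pose N : set T := (\bigcap_i W i) `\` A.
exists N; split; first by apply: measurableD => //; exact: bigcapT_measurable.
  apply/eqP; rewrite eq_le measure_ge0 andbT; apply/lee_addgt0Pr => e e0.
  rewrite add0e.
  have [n _ /(_ n (leqnn n)) ne] := near_infty_natSinv_lt (PosNum e0).
  have [_ AW muW] := WP n.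
  have Wfin : (mu (W n) < +oo)%E.
    by apply: le_lt_trans muW _; rewrite lte_add_pinfty // ltry.
  apply: (@le_trans _ _ (mu (W n `\` A))).
    apply: le_measure; rewrite ?inE.
    - by apply: measurableD => //; exact: bigcapT_measurable.
    - exact: measurableD.
    - by move=> x [Wx nAx]; split => //; exact: Wx.
  rewrite measureD // setIidr // leeBlDr ?fin_num_fun_lty //.
    by rewrite addeC (le_trans muW) // leeD2l // lee_fin ltW.
  by rewrite ge0_fin_numE.
move=> x /= nx; apply: contrapT => Nx; apply: nx => Ox.
rewrite [\1_A x]indicE; case: (boolP (x \in A)) => [|].
  rewrite inE => Ax; rewrite (_ : (fun n => \1_(Z n) x) = cst 1).
    exact: cvg_cst.
  by apply/funext => n; rewrite indicE mem_set //; exact: AZ.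
rewrite notin_setE => nAx.
have [i Wix] : exists i, ~ W i x.
  by apply/existsNP => Wx; apply: Nx; split => // i _; exact: Wx.
apply: cvg_near_cst; near=> n; rewrite indicE memNset // => -[_].
rewrite -bigcap_seq => /(_ i) /= Wx; apply: Wix; apply: Wx.
by rewrite mem_iota /= add0n; near: n; exact: nbhs_infty_gt.
Unshelve. all: by end_near. Qed.

End approximable_functions.

(** * Exhaustion by regular boxes and density for real functions *)

Section density.
Context (R : realType) (d : nat) (Omega : set 'rV[R]_d).
Context (Phi : 'rV[R]_d -> R -> R).
Context (oOmega : open Omega) (moPhi : musielak_orlicz Omega Phi).
Local Notation mu := (@lebesgueRd R d).
Local Notation T := (lebesgueRdType R d).
Local Notation J := (rmodular Omega Phi).
Implicit Types (u v w h g : 'rV[R]_d -> R) (x : 'rV[R]_d).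

Let mOmega : measurable (Omega : set T).
Proof. exact: open_measurable_Rd. Qed.

(** A single box serves for all t, as in the negation of the condition defining [Sing]. *)
Definition regular_box (n : nat) : Prop := @ratbox R d n `<=` Omega /\
  forall t, 0 < t -> (\int[mu]_(y in ratbox n) (Phi y t)%:E < +oo)%E.

Definition regular_union (n : nat) : set 'rV[R]_d :=
  \bigcup_(m in [set m | (m < n)%N /\ regular_box m]) ratbox m.

Lemma open_regular_union n : open (regular_union n).
Proof. by apply: bigcup_open => m _; exact: open_ratbox. Qed.

Lemma regular_union_sub n : regular_union n `<=` Omega.
Proof. by move=> x [m [_ [mO _]]] /mO. Qed.

Lemma lebesgueRd_regular_union n : (mu (regular_union n) < +oo)%E.
Proof.
apply: (@le_lt_trans _ _ (mu (\big[setU/set0]_(m < n) (ratbox m : set T)))).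
  apply: le_lebesgue_outer => x [m [mn _] mx]; rewrite -bigcup_mkord.
  by exists m.
apply: le_lt_trans (Boole_inequality _ _) _.
  by move=> m _; exact: measurable_ratbox.
by apply: lte_sum_pinfty => m _; exact: lebesgueRd_ratbox_lty.
Qed.

Lemma finite_modulars_regular_box m : regular_box m ->
  finite_modulars Omega Phi \1_(@ratbox R d m).
Proof.
move=> [mO mfin]; split.
  exact/measurable_indic_Rd/measurable_ratbox.
move=> l l0; apply: le_lt_trans (mfin l l0).
rewrite -[ratbox m in leRHS](setIidr mO) integral_mkcondr /rmodular.
rewrite le_eqVlt; apply/orP; left; apply/eqP; apply: eq_integral => x.
rewrite inE => Ox; rewrite patchE indicE; case: ifPn => _.
  by rewrite mulr1 ger0_norm // ltW.
by rewrite mulr0 normr0 (Phi0 moPhi).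
Qed.

(** The indicator of the union is at most the sum of the indicators of its boxes, and finite
    modulars are stable under sums and domination. *)
Lemma finite_modulars_regular_union n :
  finite_modulars Omega Phi \1_(regular_union n).
Proof.
elim: n => [|n IH].
  rewrite (_ : regular_union 0 = set0); last first.
    by rewrite -subset0 => x [m []].
  rewrite indic0; split; first exact: measurable_cst.
  move=> l l0; rewrite /rmodular integral0_eq // => x Ox.
  by rewrite mulr0 normr0 (Phi0 moPhi).
have mU : measurable_fun (Omega : set T) (\1_(regular_union n.+1) : T -> R).
  exact/measurable_indic_Rd/open_measurable_Rd/open_regular_union.
have [nreg|nreg] := pselect (regular_box n); last first.
  apply: (finite_modulars_le oOmega moPhi IH mU) => x _.
  rewrite !indicE; case: (boolP (x \in regular_union n.+1)) => [|_].
    rewrite inE => -[m [mn mreg] mx]; rewrite mem_set //; exists m => //.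
    split => //; move: mn; rewrite ltnS leq_eqVlt => /orP[/eqP mn|//].
    by rewrite mn in mreg.
  by rewrite normr0 normr_ge0.
apply: (finite_modulars_le oOmega moPhi
  (finite_modularsD oOmega moPhi IH (finite_modulars_regular_box nreg)) mU).
move=> x _; rewrite !indicE.
case: (boolP (x \in regular_union n.+1)) => [|_]; last first.
  by rewrite normr0 normr_ge0.
rewrite inE => -[m [mn mreg] mx].
move: mn; rewrite ltnS leq_eqVlt => /orP[/eqP mn|mn].
  have xn : x \in ratbox n by rewrite -mn inE.
  by rewrite xn normr1 ger0_norm // lerDr.
have xn : x \in regular_union n by rewrite inE; exists m.
by rewrite xn normr1 ger0_norm // lerDl.
Qed.

Lemma measurable_eball x (r : R) : 0 < r -> measurable (eball x r : set T).
Proof.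
move=> r0.
have mS : measurable_fun [set: T]
    (fun y : T => \sum_(i < d) (y ord0 i - x ord0 i) ^+ 2).
  apply: measurable_sum => i; apply: measurable_funX.
  by apply: measurable_funB; [exact: measurable_coord|exact: measurable_cst].
have -> : eball x r = setT `&` (fun y : T =>
    \sum_(i < d) (y ord0 i - x ord0 i) ^+ 2) @^-1` `]-oo, (r ^+ 2)[%classic.
  rewrite setTI; apply/seteqP; split => y; rewrite /eball /= in_itv /=.
    by rewrite -{1}(gtr0_norm r0) -sqrtr_sqr ltr_sqrt ?exprn_gt0.
  by rewrite -{2}(gtr0_norm r0) -sqrtr_sqr ltr_sqrt ?exprn_gt0.
exact: mS.
Qed.

Lemma regular_union_cover x : Omega x -> ~ Sing Omega Phi x ->
  exists n, regular_union n x.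
Proof.
move=> Ox /existsNP[r /not_implyP[r0 /forall2NP Phir]].
have /nbhs_ballP[s /= s0 sO] : nbhs x Omega by exact: open_nbhs_nbhs.
(* The bound s keeps the box inside Omega. Coordinates within r / (d + 1) give Euclidean distance
   below r, since d < (d + 1)^2; using d + 1 also covers d = 0. *)
pose e := Order.min s (r / d.+1%:R).
have e0 : 0 < e by rewrite lt_min s0 divr_gt0 // ltr0n.
have [n [nx ne]] := ratbox_near x e0.
have nO : ratbox n `<=` Omega.
  move=> y ny; apply: sO; split=> // j k; rewrite (ord1 j) /ball /= distrC.
  by rewrite (lt_le_trans (ne y ny k)) // ge_min lexx.
have nr : ratbox n `<=` eball x r.
  move=> y ny; rewrite /eball /=.
  rewrite -[ltRHS](gtr0_norm r0) -sqrtr_sqr ltr_sqrt ?exprn_gt0 //.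
  apply: (@le_lt_trans _ _ (\sum_(i < d) (r / d.+1%:R) ^+ 2)).
    apply: ler_sum => i _; rewrite -real_normK ?num_real // lerXn2r ?nnegrE //.
      by rewrite divr_ge0 // ltW.
    by rewrite ltW // (lt_le_trans (ne y ny i)) // ge_min lexx orbT.
  rewrite sumr_const card_ord -[ltLHS]mulr_natr expr_div_n.
  rewrite [ltLHS]mulrAC ltr_pdivrMr.
    by rewrite ltr_pM2l ?exprn_gt0 // -natrX ltr_nat expnS expn1; nia.
  by rewrite exprn_gt0 // ltr0n.
exists n.+1, n => //; split => //; split => // t t0.
have [//|Phit] := Phir t.
apply: (@le_lt_trans _ _ (\int[mu]_(y in eball x r `&` Omega) (Phi y t)%:E)%E).
  apply: ge0_subset_integral => //.
  - exact: measurable_ratbox.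
  - by apply: measurableI => //; exact: measurable_eball.
  - apply/measurable_EFinP; apply: (measurable_funS mOmega).
      exact: subIsetr.
    by case: moPhi => _ _ _; apply; exact: ltW.
  - by move=> y [_ Oy]; rewrite lee_fin (Phi_ge0 moPhi) // ltW.
  - by move=> y ny; split; [exact: nr|exact: nO].
by rewrite ltey; apply/eqP.
Qed.

Context (singPhi : mu (Sing Omega Phi) = 0%E).

Lemma approximable_sum (I : eqType) (s : seq I) (F : I -> 'rV[R]_d -> R) :
  (forall i, i \in s -> approximable Omega Phi (F i)) ->
  approximable Omega Phi (fun x => \sum_(i <- s) F i x).
Proof.
elim: s => [|i s IH] Fs.
  (* The empty sum is written as a multiple of an indicator already known to be approximable. *)
  rewrite (_ : (fun x => _) = (fun x => 0 * \1_(regular_union 0) x)); last first.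
    by apply/funext => x; rewrite big_nil mul0r.
  apply: (approximableZ oOmega moPhi); apply: (approximable_open oOmega moPhi).
  - exact: open_regular_union.
  - exact: regular_union_sub.
  - exact: finite_modulars_regular_union.
rewrite (_ : (fun x => _) = (fun x => F i x + \sum_(j <- s) F j x)); last first.
  by apply/funext => x; rewrite big_cons.
apply: (approximableD oOmega moPhi); first by apply: Fs; rewrite inE eqxx.
by apply: IH => j js; apply: Fs; rewrite inE js orbT.
Qed.

Import HBNNSimple.

(** Each level set cut by [regular_union n] has finite measure and lies in an open set whose
    indicator has finite modulars, so [approximable_indic] handles it. *)
Lemma approximable_simple (s : {nnsfun T >-> R}) n :
  approximable Omega Phi (fun x => s x * \1_(regular_union n) x).
Proof.
rewrite (_ : (fun x => _) = (fun x =>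
    \sum_(y <- finmap.enum_fset (fset_set (range s)))
    y * \1_(s @^-1` [set y] `&` regular_union n) x)); last first.
  apply/funext => x; rewrite [s x]fimfunE fsbig_finite //= mulr_suml.
  by apply: eq_bigr => y _; rewrite indicI /= mulrA.
apply: approximable_sum => y _; apply: (approximableZ oOmega moPhi).
apply: (@approximable_indic _ _ _ _ oOmega moPhi
  (s @^-1` [set y] `&` regular_union n) (regular_union n)).
- exact: open_regular_union.
- exact: regular_union_sub.
- exact: finite_modulars_regular_union.
- by apply: measurableI => //; apply: open_measurable_Rd; exact: open_regular_union.
- exact: subIsetr.
apply: le_lt_trans (lebesgueRd_regular_union n).
by apply: le_lebesgue_outer; exact: subIsetr.
Qed.

(** Simple functions increasing to u, cut off to the regular unions, tend to u off [Sing] and have u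
    itself as majorant. *)
Lemma approximable_ge0 u : finite_modulars Omega Phi u ->
  (forall x, Omega x -> 0 <= u x) -> approximable Omega Phi u.
Proof.
move=> fu u0; have [mu_ _] := fu.
have mEu : measurable_fun (Omega : set T) (EFin \o u) by exact/measurable_EFinP.
pose s := nnsfun_approx mOmega mEu.
have s_nd := nd_nnsfun_approx mOmega mEu.
have s_cvg := cvg_nnsfun_approx mOmega mEu u0.
have {}s_cvg x : Omega x -> s n x @[n --> \oo] --> u x.
  by move=> Ox; have /fine_cvgP[] := s_cvg x Ox.
have su n x : Omega x -> s n x <= u x.
  move=> Ox; rewrite -(cvg_lim _ (s_cvg x Ox)) //.
  apply: nondecreasing_cvgn_le; last by apply: cvgP; exact: s_cvg.
  by move=> m k mk; have /lefP := s_nd _ _ mk; apply.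
apply: (@approximable_cvg _ _ _ _ oOmega moPhi
    (fun n x => s n x * \1_(regular_union n) x) u u).
- by move=> n; exact: approximable_simple.
- exact: mu_.
- exact: fu.
- move=> n x Ox; rewrite normrM !ger0_norm ?indicE ?ler0n //.
  case: (x \in _); first by rewrite mulr1 su.
  by rewrite mulr0 u0.
- by move=> x Ox; rewrite ger0_norm // u0.
apply: negligibleS (lebesgueRd_negligible singPhi) => x /= nx.
apply: contrapT => Sx; apply: nx => Ox.
have [N [m [mN mreg] mx]] := regular_union_cover Ox Sx.
rewrite -[X in _ --> X]mulr1; apply: cvgM; first exact: s_cvg.
apply: cvg_near_cst; near=> n; rewrite indicE mem_set //; exists m => //.
split => //; apply: leq_trans mN _.
by near: n; exact: nbhs_infty_ge.
Unshelve. all: by end_near. Qed.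

Lemma finite_modulars_approximable u : finite_modulars Omega Phi u ->
  approximable Omega Phi u.
Proof.
move=> fu; have [mu_ _] := fu.
have mabs : measurable_fun (Omega : set T) (fun x => `|u x|).
  exact: measurableT_comp.
(* The values c = 1 and c = -1 give the positive and the negative part of u. *)
have part c : `|c| <= 1 ->
    approximable Omega Phi (fun x => 2^-1 * (`|u x| + c * u x)).
  move=> c1; apply: approximable_ge0.
    apply: (finite_modulars_le oOmega moPhi fu).
      apply: measurable_funM; first exact: measurable_cst.
      apply: measurable_funD; first exact: mabs.
      by apply: measurable_funM; [exact: measurable_cst|exact: mu_].
    move=> x _; rewrite normrM ger0_norm ?invr_ge0 // ler_pdivrMl //.
    rewrite mulr2n mulrDl !mul1r (le_trans (ler_normD _ _)) // normr_id lerD2l.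
    by rewrite normrM ler_piMl.
  move=> x _; rewrite mulr_ge0 ?invr_ge0 // -lerBlDr sub0r.
  rewrite (le_trans (ler_norm _)) // normrN normrM ler_piMl //.
rewrite (_ : u = fun x => 2^-1 * (`|u x| + 1 * u x) +
    (-1) * (2^-1 * (`|u x| + (-1) * u x))); last first.
  by apply/funext => x; field.
apply: (approximableD oOmega moPhi); first by apply: part; rewrite normr1.
by apply: (approximableZ oOmega moPhi); apply: part; rewrite normrN1.
Qed.

End density.

(** * Complex-valued functions *)

Section complex_modulus.
Context (R : realType).
Implicit Types z : R[i].
Import ComplexField.Normc.

Lemma normcE z : normc z = Num.sqrt (complex.Re z ^+ 2 + complex.Im z ^+ 2).
Proof. by case: z. Qed.

Lemma normc_ge0 z : 0 <= normc z.
Proof. by rewrite normcE sqrtr_ge0. Qed.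

Lemma normr_Re_le z : `|complex.Re z| <= normc z.
Proof. by rewrite normcE -sqrtr_sqr ler_wsqrtr // lerDl sqr_ge0. Qed.

Lemma normr_Im_le z : `|complex.Im z| <= normc z.
Proof. by rewrite normcE -sqrtr_sqr ler_wsqrtr // lerDr sqr_ge0. Qed.

Lemma normc_le z : normc z <= `|complex.Re z| + `|complex.Im z|.
Proof.
rewrite normcE -[leRHS]ger0_norm ?addr_ge0 // -sqrtr_sqr ler_wsqrtr //.
rewrite sqrrD !real_normK ?num_real // addrAC lerDl.
by rewrite mulrn_wge0 // mulr_ge0.
Qed.

Lemma ReM_real (l : R) z : complex.Re ((l%:C)%C * z) = l * complex.Re z.
Proof. by case: z => a b /=; rewrite mul0r subr0. Qed.

Lemma ImM_real (l : R) z : complex.Im ((l%:C)%C * z) = l * complex.Im z.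
Proof. by case: z => a b /=; rewrite mul0r addr0. Qed.

Lemma normcM_real (l : R) z : 0 <= l -> normc ((l%:C)%C * z) = l * normc z.
Proof.
move=> l0; rewrite !normcE ReM_real ImM_real !exprMn -mulrDr.
by rewrite sqrtrM ?sqr_ge0 // sqrtr_sqr ger0_norm.
Qed.

Lemma invc_real (l : R) : ((l%:C)%C)^-1 = ((l^-1)%:C)%C :> R[i].
Proof. by rewrite fmorphV. Qed.

End complex_modulus.

(** * Modulars and norm of complex functions, and the closure of the smooth functions *)

Section complex_spaces.
Context (R : realType) (d : nat) (Omega : set 'rV[R]_d).
Context (Phi : 'rV[R]_d -> R -> R).
Context (oOmega : open Omega) (moPhi : musielak_orlicz Omega Phi).
Local Notation mu := (@lebesgueRd R d).
Local Notation T := (lebesgueRdType R d).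
Local Notation J := (rmodular Omega Phi).
Implicit Types f g : 'rV[R]_d -> R[i].
Import ComplexField.Normc.

Lemma modularE f : modular Omega Phi f = J (fun x => normc (f x)).
Proof.
by apply: eq_integral => x _; rewrite ger0_norm // normc_ge0.
Qed.

Lemma modularZ f (l : R) : 0 <= l ->
  modular Omega Phi (fun x => (l%:C)%C * f x) = J (fun x => l * normc (f x))%R.
Proof.
move=> l0; rewrite modularE; congr rmodular; apply/funext => x.
exact: normcM_real.
Qed.

Lemma measurable_normc f : L0 Omega f ->
  measurable_fun (Omega : set T) (fun x => normc (f x)).
Proof.
move=> [mRe mIm].
rewrite (_ : (fun x => _) = Num.sqrt \o
    (fun x => complex.Re (f x) ^+ 2 + complex.Im (f x) ^+ 2)); last first.
  by apply/funext => x; rewrite normcE.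
apply: measurableT_comp.
  by apply: continuous_measurable_fun; exact: sqrt_continuous.
by apply: measurable_funD; exact: measurable_funX.
Qed.

(** The modulus dominates both parts and is at most the sum of their absolute values. *)
Lemma EPhiP f : EPhi Omega Phi f <->
  finite_modulars Omega Phi (fun x => complex.Re (f x)) /\
  finite_modulars Omega Phi (fun x => complex.Im (f x)).
Proof.
split=> [[Lf fJ]|[fRe fIm]].
  have fn : finite_modulars Omega Phi (fun x => normc (f x)).
    split=> [|l l0]; first exact: measurable_normc.
    by rewrite -modularZ ?(ltW l0) //; exact: fJ.
  have [mRe mIm] := Lf.
  split; [apply: (finite_modulars_le oOmega moPhi fn mRe) => x _|
          apply: (finite_modulars_le oOmega moPhi fn mIm) => x _].
    by rewrite [leRHS]ger0_norm ?normc_ge0 // normr_Re_le.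
  by rewrite [leRHS]ger0_norm ?normc_ge0 // normr_Im_le.
have Lf : L0 Omega f by split; [case: fRe|case: fIm].
have mn := measurable_normc Lf.
have fabs u : finite_modulars Omega Phi u ->
    finite_modulars Omega Phi (fun x => `|u x|).
  move=> fu; have [mu_ _] := fu.
  apply: (finite_modulars_le oOmega moPhi fu).
    by apply: measurableT_comp => //; exact: measurable_normr.
  by move=> x _; rewrite normr_id.
have [_ nJ] : finite_modulars Omega Phi (fun x => normc (f x)).
  apply: (finite_modulars_le oOmega moPhi
    (finite_modularsD oOmega moPhi (fabs _ fRe) (fabs _ fIm)) mn) => x _.
  rewrite ger0_norm ?normc_ge0 // [leRHS]ger0_norm ?addr_ge0 //.
  exact: normc_le.
by split => // l l0; rewrite modularZ ?(ltW l0) //; exact: nJ.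
Qed.

Lemma EPhi_LPhi f : EPhi Omega Phi f -> LPhi Omega Phi f.
Proof. by move=> [Lf fJ]; split => //; exists 1 => //; exact: fJ. Qed.

Lemma luxemburg_lt_modular f (e : R) : (luxemburg Omega Phi f < e%:E)%E ->
  exists2 l, 0 < l < e & (J (fun x => l^-1 * normc (f x))%R <= 1)%E.
Proof.
move=> /ereal_inf_lt[_ [l [l0 fl] <-]]; rewrite lte_fin => le.
exists l; first by rewrite l0 le.
move: fl; rewrite (_ : (fun x => _) = (fun x => ((l^-1)%:C)%C * f x)).
  by rewrite modularZ // invr_ge0 ltW.
by apply/funext => x; rewrite invc_real mulrC.
Qed.

Lemma modular_luxemburg_le f (l : R) : 0 < l ->
  (J (fun x => l^-1 * normc (f x))%R <= 1)%E ->
  (luxemburg Omega Phi f <= l%:E)%E.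
Proof.
move=> l0 fl; apply: ereal_inf_lbound; exists l => //; split => //.
rewrite (_ : (fun x => _) = (fun x => ((l^-1)%:C)%C * f x)).
  by rewrite modularZ // invr_ge0 ltW.
by apply/funext => x; rewrite invc_real mulrC.
Qed.

Lemma L0B f g : L0 Omega f -> L0 Omega g -> L0 Omega (fun x => f x - g x).
Proof.
move=> [fRe fIm] [gRe gIm]; split.
  rewrite (_ : (fun x => _) = fun x => complex.Re (f x) - complex.Re (g x)).
    exact: measurable_funB.
  by apply/funext => x; rewrite raddfB.
rewrite (_ : (fun x => _) = fun x => complex.Im (f x) - complex.Im (g x)).
  exact: measurable_funB.
by apply/funext => x; rewrite raddfB.
Qed.

(** E^Phi is closed: if f - g has norm below 1 / (2 l), the modular of l f is at most 1 plus the
    modular of 2 l g, which is finite. *)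
Lemma norm_closure_EPhi (A : set ('rV[R]_d -> R[i])) :
  A `<=` EPhi Omega Phi -> norm_closure Omega Phi A `<=` EPhi Omega Phi.
Proof.
move=> AE f [[Lf _] fA]; split => // l l0.
have l20 : 0 < 2 * l by rewrite mulr_gt0.
have l2i : 0 < (2 * l)^-1 by rewrite invr_gt0.
have [g Ag /luxemburg_lt_modular[k /andP[k0 kl] Jk]] := fA _ l2i.
have [Lg gJ] := AE _ Ag.
have mfg := measurable_normc (L0B Lf Lg).
have mf := measurable_normc Lf; have mg := measurable_normc Lg.
rewrite modularZ ?(ltW l0) //.
apply: (@le_lt_trans _ _ (J (fun x => k^-1 * normc (f x - g x))%R +
                          J (fun x => (2 * l) * normc (g x))%R)%E).
  apply: (rmodularD oOmega moPhi).
  - by apply: measurable_funM; [exact: measurable_cst|exact: mf].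
  - by apply: measurable_funM; [exact: measurable_cst|exact: mfg].
  - by apply: measurable_funM; [exact: measurable_cst|exact: mg].
  move=> x _; rewrite !ger0_norm ?mulr_ge0 ?invr_ge0 ?normc_ge0 ?(ltW k0)
    ?(ltW l0) //.
  have -> : 2 * (l * normc (f x)) = 2 * l * normc (f x - g x + g x).
    by rewrite subrK mulrA.
  apply: (@le_trans _ _ (2 * l * (normc (f x - g x) + normc (g x)))).
    by rewrite ler_wpM2l ?(ltW l20) // le_normcD.
  rewrite mulrDr lerD2r ler_wpM2r ?normc_ge0 //.
  by rewrite -[leLHS]invrK lef_pV2 ?posrE ?invr_gt0 // ltW.
apply: lte_add_pinfty; first by apply: le_lt_trans Jk _; exact: ltry.
by rewrite -modularZ ?(ltW l20) //; exact: gJ.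
Qed.

Lemma EPhi_norm_closure f : mu (Sing Omega Phi) = 0%E -> EPhi Omega Phi f ->
  norm_closure Omega Phi (CCinfty Omega `&` EPhi Omega Phi) f.
Proof.
move=> singPhi Ef; split=> [|e e0]; first exact: EPhi_LPhi.
have [fRe fIm] := (EPhiP f).1 Ef.
have e20 : 0 < e / 2 by rewrite divr_gt0.
(* The target is modular at most 1 for (f - g) / (e / 2), so that the norm is at most e / 2 < e.
   Splitting into real and imaginary parts costs the factor 2, and each part contributes at most 1 /
   2. *)
pose l := 2 * (e / 2)^-1.
have l0 : 0 < l by rewrite mulr_gt0 // invr_gt0.
have l2e : 2 * (e / 2)^-1 = l by [].
clearbody l; have half : 0 < 2^-1 :> R by rewrite invr_gt0.
have [_ /(_ _ _ l0 half)[u [Cu su fu Ju]]] :=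
  finite_modulars_approximable oOmega moPhi singPhi fRe.
have [_ /(_ _ _ l0 half)[v [Cv sv fv Jv]]] :=
  finite_modulars_approximable oOmega moPhi singPhi fIm.
pose g x := (u x +i* v x)%C.
have Eg : EPhi Omega Phi g by apply/EPhiP; split.
have [mRe _] := fRe; have [mIm _] := fIm; have [mu_ _] := fu; have [mv _] := fv.
have [K [cK KO suppK]] : exists K, [/\ compact K, K `<=` Omega & supp g `<=` K].
  have [K [cK KO uK]] := su; have [L [cL LO vL]] := sv.
  have cKL : compact (K `|` L) by exact: compactU.
  exists (K `|` L); split => //; first by move=> x [/KO|/LO].
  (* The support is a closure, so the set containing the nonzero values must be closed; a compact
     set is, the space being Hausdorff. *)
  have clKL : closed (K `|` L) := compact_closed (@norm_hausdorff _ _) cKL.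
  rewrite ((closure_id _).1 clKL); apply: closureS => x /= gx.
  apply: contrapT => /not_orP[Kx Lx].
  by move: gx; rewrite /g uK // vL // eqxx.
exists g.
  split => //; split.
  - by move=> k; split; [exact: Cu|exact: Cv].
  - by apply: subclosed_compact cK suppK; exact: closed_closure.
  - exact: subset_trans KO.
apply: (@le_lt_trans _ _ (e / 2)%:E); last first.
  by rewrite lte_fin ltr_pdivrMr // ltr_pMr // ltr1n.
apply: modular_luxemburg_le => //.
apply: (@le_trans _ _ (2^-1%:E + 2^-1%:E)%E); last first.
  by rewrite -EFinD lee_fin; lra.
apply: le_trans (leeD Ju Jv); apply: (rmodularD oOmega moPhi).
- apply: measurable_funM; first exact: measurable_cst.
  by apply/measurable_normc/L0B; [case: Ef|case: Eg].
- by apply: measurable_funM; [exact: measurable_cst|exact: measurable_funB].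
- by apply: measurable_funM; [exact: measurable_cst|exact: measurable_funB].
move=> x _; rewrite !normrM (ger0_norm (normc_ge0 _)) -mulrDr.
rewrite (gtr0_norm l0) [ `|(e / 2)^-1|]gtr0_norm ?invr_gt0 // mulrA l2e.
rewrite ler_wpM2l ?(ltW l0) //; apply: le_trans (normc_le _) _.
by rewrite !raddfB.
Qed.

End complex_spaces.

Theorem theorem10 (R : realType) (d : nat) (Omega : set 'rV[R]_d)
    (Phi : 'rV[R]_d -> R -> R)
    (openOmega : open Omega)
    (moPhi : musielak_orlicz Omega Phi)
    (singPhi : lebesgueRd (Sing Omega Phi) = 0%E) :
  norm_closure Omega Phi (CCinfty Omega `&` EPhi Omega Phi) = EPhi Omega Phi.
Proof.
apply/seteqP; split; first by apply: norm_closure_EPhi => // f [].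
by move=> f; exact: EPhi_norm_closure.
Qed.
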